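(* Let $\Bbbk$ be a field of characteristic $p>0$, let $n\ge1$, let $\sigma=(s_{i,j})_{1\le i,j\le n}$ be a shift matrix, and let $\mathfrak g_\sigma$ be the shifted current algebra. The centre $Z(\mathfrak g_\sigma)$ of the universal enveloping algebra $U(\mathfrak g_\sigma)$ is generated by $\{z_r : r\ge0\}$ and the $p$-centre $Z_p(\mathfrak g_\sigma)$. In fact, $Z(\mathfrak g_\sigma)$ is freely generated (as a commutative algebra) by $$\{z_r : r\ge0\}\cup\{(e_{i,j}t^r)^p-\delta_{i,j}e_{i,j}t^{rp} : 1\le i,j\le n,\ (i,j)\ne(1,1),\ r\ge s_{i,j}\}.$$
   Context: The current algebra $\mathfrak g=\mathfrak{gl}_n[t]:=\mathfrak{gl}_n(\Bbbk)\otimes\Bbbk[t]$ has basis $e_{i,j}t^r:=e_{i,j}\otimes t^r$ ($1\le i,j\le n$, $r\ge0$; $e_{i,j}$ the matrix units) and bracket $[e_{i,j}t^r,e_{k,l}t^s]=\delta_{k,j}e_{i,l}t^{r+s}-\delta_{l,i}e_{k,j}t^{r+s}$. A shift matrix is an $n\times n$ array $\sigma=(s_{i,j})$ of non-negative integers with $s_{i,j}+s_{j,k}=s_{i,k}$ whenever $|i-j|+|j-k|=|i-k|$. The shifted current algebra $\mathfrak g_\sigma$ is the Lie subalgebra of $\mathfrak g$ spanned by $\{e_{i,j}t^r : 1\le i,j\le n,\ r\ge s_{i,j}\}$. Set $z_r:=e_{1,1}t^r+\cdots+e_{n,n}t^r\in\mathfrak g_\sigma$ for $r\ge 0$. $\mathfrak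 g$ is a restricted Lie algebra with $p$-map $x\mapsto x^{[p]}$ determined by $(e_{i,j}t^r)^{[p]}:=\delta_{i,j}e_{i,j}t^{rp}$ (with $x\mapsto x^p-x^{[p]}\in U(\mathfrak g)$ being $p$-semilinear), and $\mathfrak g_\sigma$ is a restricted subalgebra. The $p$-centre $Z_p(\mathfrak g_\sigma)$ is the subalgebra of $Z(\mathfrak g_\sigma)$ generated by all $x^p-x^{[p]}$, $x\in\mathfrak g_\sigma$; equivalently it is generated by the elements $(e_{i,j}t^r)^p-\delta_{i,j}e_{i,j}t^{rp}$ with $1\le i,j\le n$, $r\ge s_{i,j}$. ''Freely generated'' means generated by algebraically independent elements. *)

(* Defs.v *)
From HB Require Import structures.
From mathcomp Require Import all_boot all_order all_algebra.
From mathcomp Require Import finmap boolp classical_sets.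
From mathcomp Require Import monalg zify.
From mathcomp Require mpoly.

Set Implicit Arguments.
Unset Strict Implicit.
Unset Printing Implicit Defensive.

Import GRing.Theory.
Local Open Scope classical_set_scope.
Local Open Scope quotient_scope.
Local Open Scope ring_scope.

(******************************************************************************)
(* Quotient of an associative algebra by a proper two-sided ideal             *)
(******************************************************************************)

Section GeneratedIdeal.
Variables (k : comPzRingType) (A : algType k).

Inductive gen_ideal2 (S : set A) : A -> Prop :=
| GI_gen x : S x -> gen_ideal2 S x
| GI_0 : gen_ideal2 S 0
| GI_add x y : gen_ideal2 S x -> gen_ideal2 S y -> gen_ideal2 S (x + y)
| GI_mull a x : gen_ideal2 S x -> gen_ideal2 S (a * x)
| GI_mulr a x : gen_ideal2 S x -> gen_ideal2 S (x * a).

Lemma gen_ideal2_morph (S : set A) (B : algType k) (f : {lrmorphism A -> B}) :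
  (forall x, S x -> f x = 0) -> forall x, gen_ideal2 S x -> f x = 0.
Proof.
move=> fS x; elim=> [{}x /fS //||{}x y _ fx _ fy|a {}x _ fx|a {}x _ fx].
- exact: raddf0.
- by rewrite raddfD /= fx fy addr0.
- by rewrite rmorphM /= fx mulr0.
- by rewrite rmorphM /= fx mul0r.
Qed.

End GeneratedIdeal.

Section QuotientAlgebra.
Variables (k : comPzRingType) (A : algType k).

Record proper_ideal2 := ProperIdeal2 {
  ideal2 :> A -> Prop;
  ideal2_0 : ideal2 0;
  ideal2D : forall x y, ideal2 x -> ideal2 y -> ideal2 (x + y);
  ideal2Ml : forall a x, ideal2 x -> ideal2 (a * x);
  ideal2Mr : forall a x, ideal2 x -> ideal2 (x * a);
  ideal2_1 : ~ ideal2 1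
}.

Variable I : proper_ideal2.

Lemma ideal2N x : I x -> I (- x).
Proof. by rewrite -mulN1r; exact: ideal2Ml. Qed.

Definition ideal2_equiv (x y : A) : bool := `[< I (x - y) >].

Lemma ideal2_equiv_refl : reflexive ideal2_equiv.
Proof. by move=> x; apply/asboolP; rewrite subrr; exact: ideal2_0. Qed.

Lemma ideal2_equiv_sym : symmetric ideal2_equiv.
Proof. by move=> x y; apply/asboolP/asboolP => /ideal2N; rewrite opprB. Qed.

Lemma ideal2_equiv_trans : transitive ideal2_equiv.
Proof.
move=> y x z /asboolP xy /asboolP yz; apply/asboolP.
by rewrite -(subrKA y); exact: ideal2D.
Qed.

Canonical ideal2_equivRel := EquivRel ideal2_equiv
  ideal2_equiv_refl ideal2_equiv_sym ideal2_equiv_trans.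

Definition alg_quot := {eq_quot ideal2_equiv}.
HB.instance Definition _ := Choice.on alg_quot.
HB.instance Definition _ := EqQuotient.on alg_quot.

Definition quot_proj (x : A) : alg_quot := \pi_alg_quot x.

Lemma quot_projP x y : (quot_proj x = quot_proj y) <-> I (x - y).
Proof.
split=> [/eqP|xy]; first by rewrite eqmodE => /asboolP.
by apply/eqP; rewrite eqmodE; apply/asboolP.
Qed.

Lemma quot_proj_surj (x : alg_quot) : exists u, x = quot_proj u.
Proof. by exists (repr x); rewrite /quot_proj reprK. Qed.

Lemma quot_proj_repr u : I (repr (quot_proj u) - u).
Proof. by apply/quot_projP; rewrite /quot_proj reprK. Qed.

Definition quot_add (x y : alg_quot) := quot_proj (repr x + repr y).
Definition quot_opp (x : alg_quot) := quot_proj (- repr x).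
Definition quot_mul (x y : alg_quot) := quot_proj (repr x * repr y).
Definition quot_scale (a : k) (x : alg_quot) := quot_proj (a *: repr x).

Lemma quot_projD u v : quot_add (quot_proj u) (quot_proj v) = quot_proj (u + v).
Proof.
by apply/quot_projP; rewrite opprD addrACA; apply: ideal2D;
  exact: quot_proj_repr.
Qed.

Lemma quot_projN u : quot_opp (quot_proj u) = quot_proj (- u).
Proof.
by apply/quot_projP; rewrite -opprD; apply: ideal2N; exact: quot_proj_repr.
Qed.

Lemma quot_projM u v : quot_mul (quot_proj u) (quot_proj v) = quot_proj (u * v).
Proof.
apply/quot_projP.
rewrite -(subrKA (u * repr (quot_proj v))) -mulrBl -mulrBr.
by apply: ideal2D; [apply: ideal2Mr | apply: ideal2Ml]; exact: quot_proj_repr.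
Qed.

Lemma quot_projZ a u : quot_scale a (quot_proj u) = quot_proj (a *: u).
Proof.
apply/quot_projP; rewrite -scalerBr -mulr_algl.
by apply: ideal2Ml; exact: quot_proj_repr.
Qed.

Let quot_projE := (quot_projD, quot_projN, quot_projM, quot_projZ).

Lemma quot_addA : associative quot_add.
Proof.
move=> x y z; have [u ->] := quot_proj_surj x.
have [v ->] := quot_proj_surj y; have [w ->] := quot_proj_surj z.
by rewrite !quot_projE addrA.
Qed.

Lemma quot_addC : commutative quot_add.
Proof. by move=> x y; rewrite /quot_add addrC. Qed.

Lemma quot_add0 : left_id (quot_proj 0) quot_add.
Proof.
by move=> x; have [u ->] := quot_proj_surj x; rewrite !quot_projE add0r.
Qed.

Lemma quot_addN : left_inverse (quot_proj 0) quot_opp quot_add.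
Proof.
by move=> x; have [u ->] := quot_proj_surj x; rewrite !quot_projE addNr.
Qed.

HB.instance Definition _ :=
  GRing.isZmodule.Build alg_quot quot_addA quot_addC quot_add0 quot_addN.

Lemma quot_mulA : associative quot_mul.
Proof.
move=> x y z; have [u ->] := quot_proj_surj x.
have [v ->] := quot_proj_surj y; have [w ->] := quot_proj_surj z.
by rewrite !quot_projE mulrA.
Qed.

Lemma quot_mul1l : left_id (quot_proj 1) quot_mul.
Proof.
by move=> x; have [u ->] := quot_proj_surj x; rewrite !quot_projE mul1r.
Qed.

Lemma quot_mul1r : right_id (quot_proj 1) quot_mul.
Proof.
by move=> x; have [u ->] := quot_proj_surj x; rewrite !quot_projE mulr1.
Qed.

Lemma quot_mulDl : left_distributive quot_mul quot_add.
Proof.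
move=> x y z; have [u ->] := quot_proj_surj x.
have [v ->] := quot_proj_surj y; have [w ->] := quot_proj_surj z.
by rewrite !quot_projE mulrDl.
Qed.

Lemma quot_mulDr : right_distributive quot_mul quot_add.
Proof.
move=> x y z; have [u ->] := quot_proj_surj x.
have [v ->] := quot_proj_surj y; have [w ->] := quot_proj_surj z.
by rewrite !quot_projE mulrDr.
Qed.

Lemma quot_oner_neq0 : quot_proj 1 != quot_proj 0.
Proof. by apply/eqP => /quot_projP; rewrite subr0; exact: ideal2_1. Qed.

HB.instance Definition _ := GRing.Zmodule_isNzRing.Build alg_quot
  quot_mulA quot_mul1l quot_mul1r quot_mulDl quot_mulDr quot_oner_neq0.

Lemma quot_scaleA a b x : quot_scale a (quot_scale b x) = quot_scale (a * b) x.
Proof. by have [u ->] := quot_proj_surj x; rewrite !quot_projE scalerA. Qed.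

Lemma quot_scale1 : left_id 1 quot_scale.
Proof.
by move=> x; have [u ->] := quot_proj_surj x; rewrite !quot_projE scale1r.
Qed.

Lemma quot_scaleDr : right_distributive quot_scale quot_add.
Proof.
move=> a x y; have [u ->] := quot_proj_surj x.
by have [v ->] := quot_proj_surj y; rewrite !quot_projE scalerDr.
Qed.

Lemma quot_scaleDl x a b :
  quot_scale (a + b) x = quot_add (quot_scale a x) (quot_scale b x).
Proof. by have [u ->] := quot_proj_surj x; rewrite !quot_projE scalerDl. Qed.

HB.instance Definition _ := GRing.Zmodule_isLmodule.Build k alg_quot
  quot_scaleA quot_scale1 quot_scaleDr quot_scaleDl.

Lemma quot_scaleAl a x y : quot_scale a (quot_mul x y) =
  quot_mul (quot_scale a x) y.
Proof.
have [u ->] := quot_proj_surj x; have [v ->] := quot_proj_surj y.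
by rewrite !quot_projE scalerAl.
Qed.

HB.instance Definition _ :=
  GRing.Lmodule_isLalgebra.Build k alg_quot quot_scaleAl.

Lemma quot_scaleAr a x y : quot_scale a (quot_mul x y) =
  quot_mul x (quot_scale a y).
Proof.
have [u ->] := quot_proj_surj x; have [v ->] := quot_proj_surj y.
by rewrite !quot_projE scalerAr.
Qed.

HB.instance Definition _ :=
  GRing.Lalgebra_isAlgebra.Build k alg_quot quot_scaleAr.

Lemma quot_proj_is_linear : linear quot_proj.
Proof. by move=> a u v; rewrite -quot_projD -quot_projZ. Qed.

Lemma quot_proj_is_monoid_morphism : monoid_morphism quot_proj.
Proof. by split=> // u v; rewrite -quot_projM. Qed.

HB.instance Definition _ :=
  GRing.isLinear.Build k A alg_quot *:%R quot_proj quot_proj_is_linear.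
HB.instance Definition _ := GRing.isMonoidMorphism.Build A alg_quot quot_proj
  quot_proj_is_monoid_morphism.

Lemma quot_lift (B : algType k) (f : {lrmorphism A -> B}) :
    (forall x, I x -> f x = 0) ->
  exists g : {lrmorphism alg_quot -> B}, forall x, g (quot_proj x) = f x.
Proof.
move=> fI; pose g (x : alg_quot) := f (repr x).
have gE u : g (quot_proj u) = f u.
  by have /fI := quot_proj_repr u; rewrite raddfB => /subr0_eq.
have g_lin : linear g.
  move=> a x y; have [u ->] := quot_proj_surj x.
  by have [v ->] := quot_proj_surj y; rewrite -linearP !gE linearP.
have g_mul : monoid_morphism g.
  split=> [|x y]; first by rewrite -(rmorph1 quot_proj) gE rmorph1.
  have [u ->] := quot_proj_surj x; have [v ->] := quot_proj_surj y.
  by rewrite -rmorphM !gE rmorphM.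
pose gL := GRing.isLinear.Build k alg_quot B *:%R g g_lin.
pose gM := GRing.isMonoidMorphism.Build alg_quot B g g_mul.
by exists (HB.pack_for {lrmorphism alg_quot -> B} g gL gM).
Qed.

End QuotientAlgebra.

(******************************************************************************)
(* The free associative algebra on a set X                                    *)
(******************************************************************************)

Section FreeAlgebra.
Variables (k : comNzRingType) (X : choiceType).

Definition free_alg := {malg k[{fmonom X}]}.
HB.instance Definition _ := GRing.Lalgebra.on free_alg.

Definition fa_monom (m : {fmonom X}) : free_alg := mkmalgU m 1.
Definition fa_var (x : X) : free_alg := fa_monom (fmu x).

Lemma fa_monomE (u : free_alg) :
  u = \sum_(m <- msupp u) mcoeff m u *: fa_monom m.
Proof.
rewrite {1}[u]monalgE; apply: eq_bigr => m _.
by apply/malgP => m'; rewrite mcoeffZ !mcoeffU mulrnAr mulr1.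
Qed.

Lemma fa_monomM m m' : fa_monom m * fa_monom m' = fa_monom (mmul m m').
Proof. by rewrite malgM_def fgmulUU mulr1. Qed.

Lemma fa_monom_prod m : fa_monom m = \prod_(x <- m) fa_var x.
Proof.
case: m => s; elim: s => [|x s IHs] /=.
  by rewrite big_nil -fmoneE.
rewrite big_cons -IHs fa_monomM; congr fa_monom.
by apply/eqP; rewrite fmP fmM fmU.
Qed.

Lemma fa_mkmalgUZ (a c : k) (m : {fmonom X}) :
  a *: (mkmalgU m c : free_alg) = mkmalgU m (a * c).
Proof. by apply/malgP => m'; rewrite mcoeffZ !mcoeffU mulrnAr. Qed.

Lemma fa_scaleAr (a : k) (u v : free_alg) : a *: (u * v) = u * (a *: v).
Proof.
rewrite [X in a *: (X * _)]monalgE [X in _ = X * _]monalgE.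
rewrite [X in a *: (_ * X)]monalgE [X in _ * (a *: X)]monalgE.
rewrite !mulr_suml scaler_sumr scaler_sumr.
apply: eq_bigr => m _; rewrite !mulr_sumr scaler_sumr.
apply: eq_bigr => m' _; rewrite !fa_mkmalgUZ.
transitivity (mkmalgU (mmul m m') (a * (mcoeff m u * mcoeff m' v)) : free_alg).
  by rewrite -fa_mkmalgUZ; congr (_ *: _); exact: fgmulUU.
by rewrite mulrCA; apply/esym; exact: fgmulUU.
Qed.

HB.instance Definition _ :=
  GRing.Lalgebra_isAlgebra.Build k free_alg fa_scaleAr.

Section Eval.
Variables (B : algType k) (f : X -> B).

Definition fa_eval_monom (m : {fmonom X}) : B := \prod_(x <- m) f x.

Lemma fa_eval_monom_mmorphism : mmorphism fa_eval_monom.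
Proof.
split=> [m1 m2|]; first by rewrite /fa_eval_monom fmM big_cat.
by rewrite /fa_eval_monom fm1 big_nil.
Qed.

HB.instance Definition _ :=
  isMultiplicative.Build {fmonom X} B fa_eval_monom fa_eval_monom_mmorphism.

Definition fa_eval (u : free_alg) : B := mmap (in_alg B) fa_eval_monom u.

Lemma fa_eval_is_linear : linear fa_eval.
Proof. by move=> a u v; rewrite /fa_eval raddfD /= mmapZ /= mulr_algl. Qed.

Lemma fa_eval_is_monoid_morphism : monoid_morphism fa_eval.
Proof.
have comm (g : {malg k[{fmonom X}]}) m m' :
    GRing.comm (in_alg B (mcoeff m g)) (fa_eval_monom m').
  by rewrite /GRing.comm /= mulr_algl mulr_algr.
have [eM e1] := commr_mmap_is_multiplicative comm.
by split=> // u v; exact: eM.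
Qed.

HB.instance Definition _ :=
  GRing.isLinear.Build k free_alg B *:%R fa_eval fa_eval_is_linear.
HB.instance Definition _ := GRing.isMonoidMorphism.Build free_alg B fa_eval
  fa_eval_is_monoid_morphism.

Lemma fa_eval_var x : fa_eval (fa_var x) = f x.
Proof.
rewrite /fa_eval /fa_var /fa_monom mmapU /= scale1r mul1r.
by rewrite /fa_eval_monom fmU big_seq1.
Qed.

Lemma fa_eval_unique (g : {lrmorphism free_alg -> B}) :
  (forall x, g (fa_var x) = f x) -> g =1 fa_eval.
Proof.
move=> gf u; rewrite [u]fa_monomE !linear_sum; apply: eq_bigr => m _.
rewrite !linearZ /=; congr (_ *: _).
rewrite fa_monom_prod !rmorph_prod; apply: eq_bigr => x _.
exact: etrans (gf x) (esym (fa_eval_var x)).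
Qed.

End Eval.

End FreeAlgebra.

(******************************************************************************)
(* Lie algebras                                                               *)
(******************************************************************************)

HB.mixin Record Lmodule_isLieAlgebra (k : pzRingType) L
    of GRing.Lmodule k L := {
  lie : L -> L -> L;
  lie_linearl : forall a x y z, lie (a *: x + y) z = a *: lie x z + lie y z;
  lie_linearr : forall a x y z, lie z (a *: x + y) = a *: lie z x + lie z y;
  liexx : forall x, lie x x = 0;
  lie_jacobi : forall x y z,
    lie x (lie y z) + lie y (lie z x) + lie z (lie x y) = 0
}.

#[short(type="lieAlgType")]
HB.structure Definition LieAlgebra (k : pzRingType) :=
  { L of Lmodule_isLieAlgebra k L & GRing.Lmodule k L }.

(******************************************************************************)
(* The universal enveloping algebra                                           *)
(******************************************************************************)

Section UniversalEnveloping.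
Variables (k : comNzRingType) (L : lieAlgType k).

(* Modulo the first kind of relators the free algebra on the set L is the     *)
(* tensor algebra of the module L.                                            *)
Definition uenv_rel (A : algType k) (v : L -> A) : set A :=
  [set u | exists a x y, u = v (a *: x + y) - (a *: v x + v y)] `|`
  [set u | exists x y, u = v x * v y - v y * v x - v (lie x y)].

Lemma uenv_rel_morph (A B : algType k) (v : L -> A) (f : {lrmorphism A -> B})
    (w : {linear L -> B}) :
    (forall x y, w (lie x y) = w x * w y - w y * w x) ->
    (forall x, f (v x) = w x) ->
  forall u, gen_ideal2 (uenv_rel v) u -> f u = 0.
Proof.
move=> wM fv; apply: gen_ideal2_morph => u [[a [x [y ->]]]|[x [y ->]]].
- by rewrite raddfB raddfD /= linearZ /= !fv linearP subrr.
- by rewrite !raddfB /= !rmorphM /= !fv wM subrr.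
Qed.

Local Notation F := (free_alg k L).

Lemma uenv_rel_proper : ~ gen_ideal2 (uenv_rel (@fa_var k L)) 1.
Proof.
pose z : L -> k^o := \0; pose e : {lrmorphism F -> k^o} := fa_eval z.
have zM x y : z (lie x y) = z x * z y - z y * z x by rewrite mulr0 subr0.
have eV x : e (fa_var k x) = (\0 : {linear L -> k^o}) x by exact: fa_eval_var.
move=> /(uenv_rel_morph zM eV) /eqP; rewrite rmorph1.
by apply/negP; exact: oner_neq0.
Qed.

Definition uenv_ideal : proper_ideal2 F :=
  ProperIdeal2 (@GI_0 _ _ _) (@GI_add _ _ _) (@GI_mull _ _ _) (@GI_mulr _ _ _)
    uenv_rel_proper.

Definition uenv := alg_quot uenv_ideal.
HB.instance Definition _ := GRing.Algebra.on uenv.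

Definition uiota (x : L) : uenv := quot_proj uenv_ideal (fa_var k x).

Lemma uiota_is_linear : linear uiota.
Proof. 
move=> a x y; rewrite -linearP; apply/quot_projP/GI_gen.
by left; exists a, x, y.
 Qed.

HB.instance Definition _ :=
  GRing.isLinear.Build k L uenv *:%R uiota uiota_is_linear.

Lemma uiota_lie x y : uiota (lie x y) = uiota x * uiota y - uiota y * uiota x.
Proof.
rewrite -!rmorphM -raddfB; apply/esym/quot_projP/GI_gen.
by right; exists x, y.
Qed.

Theorem uenv_universal (A : algType k) (f : {linear L -> A}) :
    (forall x y, f (lie x y) = f x * f y - f y * f x) ->
  exists2 g : {lrmorphism uenv -> A},
    (forall x, g (uiota x) = f x) &
    (forall h : {lrmorphism uenv -> A},
       (forall x, h (uiota x) = f x) -> h =1 g).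
Proof.
move=> fM; pose e : {lrmorphism F -> A} := fa_eval f.
have eV x : e (fa_var k x) = f x by exact: fa_eval_var.
have eI u : uenv_ideal u -> e u = 0 by exact: (uenv_rel_morph fM eV).
have [g gE] := quot_lift eI.
exists g => [x|h hf x]; first by rewrite gE.
have [u ->] := quot_proj_surj x; rewrite gE.
by apply: (fa_eval_unique (g := h \o quot_proj uenv_ideal)) => y; exact: hf.
Qed.

End UniversalEnveloping.

(******************************************************************************)
(* The current algebra gl_n[t] = gl_n(k) (x) k[t], as the matrices M_n(k[t])  *)
(* over the base field k, with the commutator bracket (see cur_e_lie)         *)
(******************************************************************************)

Inductive lin_span (k : pzRingType) (V : lmodType k) (S : set V) : V -> Prop :=
| LS_gen x : S x -> lin_span S x
| LS_0 : lin_span S 0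
| LS_add x y : lin_span S x -> lin_span S y -> lin_span S (x + y)
| LS_scale a x : lin_span S x -> lin_span S (a *: x).

Section Current.
Variables (k : fieldType) (n : nat).

Definition current := 'M[{poly k}]_n.
HB.instance Definition _ := GRing.PzRing.on current.

Definition cur_scale (a : k) (x : current) : current := a%:P *: x.

Lemma cur_scaleA a b x : cur_scale a (cur_scale b x) = cur_scale (a * b) x.
Proof. by rewrite /cur_scale scalerA polyCM. Qed.

Lemma cur_scale1 : left_id 1 cur_scale.
Proof. by move=> x; rewrite /cur_scale scale1r. Qed.

Lemma cur_scaleDr : right_distributive cur_scale +%R.
Proof. by move=> a x y; exact: scalerDr. Qed.

Lemma cur_scaleDl x : {morph cur_scale^~ x : a b / a + b}.
Proof. by move=> a b; rewrite /cur_scale polyCD; exact: scalerDl. Qed.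

HB.instance Definition _ := GRing.Zmodule_isLmodule.Build k current
  cur_scaleA cur_scale1 cur_scaleDr cur_scaleDl.

Lemma cur_scaleAl (a : k) (x y : current) : a *: (x * y) = (a *: x) * y.
Proof. exact: scalemxAl. Qed.

Lemma cur_scaleAr (a : k) (x y : current) : a *: (x * y) = x * (a *: y).
Proof. exact: scalemxAr. Qed.

(* e_{i,j} t^r *)
Definition cur_e (i j : 'I_n) (r : nat) : current := 'X^r *: delta_mx i j.

Lemma cur_eM i j r l m s :
  cur_e i j r * cur_e l m s = if j == l then cur_e i m (r + s) else 0.
Proof.
rewrite /cur_e -[LHS]/(_ *m _) -scalemxAl -scalemxAr scalerA -exprD.
rewrite mul_delta_mx_cond; case: eqP => _; first by rewrite mulr1n.
by rewrite mulr0n scaler0.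
Qed.

Lemma cur_e_lie i j r l m s :
  cur_e i j r * cur_e l m s - cur_e l m s * cur_e i j r =
    (if l == j then cur_e i m (r + s) else 0)
    - (if m == i then cur_e l j (r + s) else 0).
Proof. by rewrite !cur_eM [j == l]eq_sym addnC. Qed.

End Current.

(******************************************************************************)
(* Shift matrices and shifted current algebras                                *)
(******************************************************************************)

Record shift_matrix (n : nat) := ShiftMatrix {
  shift_fun :> 'I_n -> 'I_n -> nat;
  shift_additive : forall i j l : 'I_n,
    (`|(i : nat) - (j : nat)| + `|(j : nat) - (l : nat)|
       = `|(i : nat) - (l : nat)|)%N ->
    (shift_fun i j + shift_fun j l = shift_fun i l)%N
}.

Section ShiftMatrix.
Variables (n : nat) (s : shift_matrix n).

Lemma shift_diag i : s i i = 0%N.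
Proof. by have := @shift_additive n s i i i; lia. Qed.

Lemma shift_triangle i j l : (s i l <= s i j + s j l)%N.
Proof.
have := @shift_additive n s i j l.
have := @shift_additive n s j i l.
have := @shift_additive n s i l j.
by lia.
Qed.

End ShiftMatrix.

Section ShiftedCurrent.
Variables (k : fieldType) (n : nat) (s : shift_matrix n).

Definition shifted_basis : set (current k n) :=
  [set x | exists i j r, (s i j <= r)%N /\ x = cur_e k i j r].

Definition in_shifted : {pred current k n} :=
  fun x => `[< lin_span shifted_basis x >].

Lemma in_shifted_submod : GRing.submod_closed in_shifted.
Proof.
split; first by apply/asboolP; exact: LS_0.
by move=> a x y /asboolP sx /asboolP sy; apply/asboolP/LS_add => //;
  exact: LS_scale.
Qed.

HB.instance Definition _ :=
  GRing.isSubmodClosed.Build k (current k n) in_shifted in_shifted_submod.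

Lemma in_shifted_e i j r : (s i j <= r)%N -> cur_e k i j r \in in_shifted.
Proof. by move=> sr; apply/asboolP/LS_gen; exists i, j, r. Qed.

Lemma in_shifted1 : 1 \in in_shifted.
Proof.
have -> : (1 : current k n) = \sum_i cur_e k i i 0.
  rewrite -[LHS]/(1%:M : 'M_n) mx1_sum_delta; apply: eq_bigr => i _.
  by rewrite /cur_e scale1r.
by apply: rpred_sum => i _; apply: in_shifted_e; rewrite shift_diag.
Qed.

Lemma in_shiftedM x y :
  x \in in_shifted -> y \in in_shifted -> x * y \in in_shifted.
Proof.
move=> /asboolP sx sy.
elim: sx => [{}x [i [j [r [sr ->]]]]||x1 x2 _ IH1 _ IH2|a {}x _ IH].
- move/asboolP: sy.
  elim=> [{}y [l [m [q [sq ->]]]]||y1 y2 _ IH1 _ IH2|a {}y _ IH].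
  + rewrite cur_eM; case: eqP => [jl|_]; last exact: rpred0.
    subst l; apply: in_shifted_e.
    by apply: leq_trans (shift_triangle s i j m) _; exact: leq_add.
  + by rewrite mulr0 rpred0.
  + by rewrite mulrDr rpredD.
  + by rewrite -cur_scaleAr rpredZ.
- by rewrite mul0r rpred0.
- by rewrite mulrDl rpredD.
- by rewrite -cur_scaleAl rpredZ.
Qed.

Lemma in_shiftedX x p : x \in in_shifted -> x ^+ p \in in_shifted.
Proof.
move=> sx; elim: p => [|p IH]; first exact: in_shifted1.
by rewrite exprS in_shiftedM.
Qed.

Record shifted := Shifted {
  shifted_val : current k n;
  shiftedP : shifted_val \in in_shifted
}.

HB.instance Definition _ := [isSub for shifted_val].
HB.instance Definition _ := [Choice of shifted by <:].
HB.instance Definition _ := [SubChoice_isSubLmodule of shifted by <:].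

Lemma in_shifted_lie (x y : shifted) :
  shifted_val x * shifted_val y - shifted_val y * shifted_val x \in in_shifted.
Proof. by rewrite rpredB // in_shiftedM // shiftedP. Qed.

Definition shifted_lie (x y : shifted) : shifted :=
  Shifted (in_shifted_lie x y).

Lemma shifted_lie_linearl a x y z :
  shifted_lie (a *: x + y) z = a *: shifted_lie x z + shifted_lie y z.
Proof.
apply: val_inj; rewrite /= mulrDl mulrDr -cur_scaleAl -cur_scaleAr scalerBr.
by rewrite opprD addrACA.
Qed.

Lemma shifted_lie_linearr a x y z :
  shifted_lie z (a *: x + y) = a *: shifted_lie z x + shifted_lie z y.
Proof.
apply: val_inj; rewrite /= mulrDl mulrDr -cur_scaleAl -cur_scaleAr scalerBr.
by rewrite opprD addrACA.
Qed.

Lemma shifted_liexx x : shifted_lie x x = 0.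
Proof. by apply: val_inj; rewrite /= subrr. Qed.

Lemma shifted_jacobi x y z :
  shifted_lie x (shifted_lie y z) + shifted_lie y (shifted_lie z x)
    + shifted_lie z (shifted_lie x y) = 0.
Proof.
apply: val_inj; rewrite /=.
move: (shifted_val x) (shifted_val y) (shifted_val z) => {x y z} x y z.
rewrite !mulrBl !mulrBr !mulrA !opprB.
set a := x * y * z; set b := x * z * y; set c := y * z * x.
set d := z * y * x; set e := y * x * z; set f := z * x * y.
rewrite [a - b + _]addrACA [c - e + _]addrACA [f - d + _]addrACA -!opprD.
by rewrite [c + b]addrC subrKA [f + e]addrC subrKA [d + a]addrC subrr.
Qed.

HB.instance Definition _ := Lmodule_isLieAlgebra.Build k shifted
  shifted_lie_linearl shifted_lie_linearr shifted_liexx shifted_jacobi.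

(* The element e_{i,j} t^r of g_sigma, for r >= s_{i,j}.                      *)
Definition sh_e i j r (sr : (s i j <= r)%N) : shifted :=
  Shifted (in_shifted_e sr).

Lemma shift_diag_le i r : (s i i <= r)%N.
Proof. by rewrite shift_diag. Qed.

Definition sh_e_diag i r : shifted := sh_e (shift_diag_le i r).

Definition sh_z r : shifted := \sum_i sh_e_diag i r.

(* The restricted structure of gl_n[t] is the p-th power in the associative   *)
(* algebra M_n(k[t]): see sh_pmap_e and p_elt_semilinear, which determine it. *)
Definition sh_pmap (p : nat) (x : shifted) : shifted :=
  Shifted (in_shiftedX p (shiftedP x)).

End ShiftedCurrent.
Section PMap.
Variables (k : fieldType) (n : nat) (s : shift_matrix n) (p : nat).
Hypothesis hp : p \in [pchar k].

Lemma sh_pmap_e i j r (sr : (s i j <= r)%N) :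
  sh_pmap p (sh_e k sr) = if i == j then sh_e_diag k s i (r * p) else 0.
Proof.
have p_pr := pcharf_prime hp; apply: val_inj => /=.
case: eqP => [ij|ij] /=.
  subst j; have : (0 < p)%N by exact: prime_gt0.
  case: (p) => // q _; elim: q => [|q IH]; first by rewrite expr1 muln1.
  by rewrite exprS IH cur_eM eqxx -mulnS.
have : (1 < p)%N by exact: prime_gt1.
case: (p) => [//|[//|q]] _; rewrite 2!exprS mulrA cur_eM.
by case: eqP => [/esym//|_]; rewrite mul0r.
Qed.

End PMap.

Section Jacobson.

Lemma pchar_bin_pred p (R : nzRingType) : p \in [pchar R] ->
  forall m, (m < p)%N -> ('C(p.-1, m))%:R = (-1) ^+ m :> R.
Proof.
move=> hp; have p_pr := pcharf_prime hp; elim=> [|m IH] mp.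
  by rewrite bin0.
have pE : p = p.-1.+1 by rewrite prednK // prime_gt0.
apply/eqP; rewrite exprS mulN1r -IH ?(ltnW mp) // -addr_eq0 -natrD -binS -pE.
by rewrite -(dvdn_pcharf hp) prime_dvd_bin.
Qed.

Variables (R : nzRingType).

Fixpoint iter_ad (w v : R) m :=
  if m is m'.+1 then w * iter_ad w v m' - iter_ad w v m' * w else v.

Lemma iter_adE w v m :
  iter_ad w v m =
  \sum_(i < m.+1) ((-1) ^+ i * ('C(m, i))%:R) * (w ^+ (m - i) * v * w ^+ i).
Proof.
elim: m => [|m IH] /=; first by rewrite big_ord1 bin0 !mul1r mulr1.
rewrite {}IH mulr_sumr mulr_suml.
rewrite [in RHS]big_ord_recl bin0 /= mulr1 mulr1 subn0.
under [X in _ = _ + X]eq_bigr => i _ do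
  rewrite /bump /= add1n subSS binS natrD mulrDr mulrDl exprS mulN1r.
rewrite big_split /= addrA; congr (_ + _).
  rewrite big_ord_recl [X in _ = _ + X]big_ord_recr /=.
  rewrite bin0 subn0 !mulr1 expr0 !mul1r !mulrA -exprS.
  rewrite bin_small // mulr0 !mul0r addr0; congr (_ + _).
  apply: eq_bigr => i _; rewrite /bump /= add1n.
  rewrite exprS mulN1r; set c := - _ * _.
  have cw : c * w = w * c.
    rewrite /c; apply/esym/commrM; last exact: commr_nat.
    by apply: commrN; apply: commr_sign.
  rewrite mulrA -cw -[LHS]mulrA; congr (_ * _).
  by rewrite !mulrA -exprS subnSK.
rewrite -sumrN; apply: eq_bigr => i _.
by rewrite !mulNr -!mulrA -exprSr.
Qed.

Lemma iter_ad_pchar p w v : p \in [pchar R] ->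
  iter_ad w v p.-1 = \sum_(i < p) w ^+ (p.-1 - i) * v * w ^+ i.
Proof.
move=> hp; have pE : p.-1.+1 = p.
  by rewrite prednK // prime_gt0 // (pcharf_prime hp).
rewrite iter_adE pE; apply: eq_bigr => i _.
by rewrite (pchar_bin_pred hp) // -exprD addnn -mul2n exprM sqrrN !expr1n mul1r.
Qed.

End Jacobson.

Section JacobsonFormula.
Variables (k : fieldType) (L : lieAlgType k) (p : nat).
Hypothesis hp : p \in [pchar k].

(* Coefficient of T^i in ad(x T + y)^m (x).                                   *)
Fixpoint jac_coef (x y : L) (m i : nat) : L :=
  if m is m'.+1 then
    (if i is i'.+1 then lie x (jac_coef x y m' i') else 0)
    + lie y (jac_coef x y m' i)
  else if i == 0%N then x else 0.

Definition jac (x y : L) : L :=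
  \sum_(1 <= i < p) (i%:R^-1 : k) *: jac_coef x y p.-1 i.-1.

Lemma mulrn_pchar_eq0 (R : nzRingType) (a : R) i :
  p \in [pchar R] -> (0 < i < p)%N -> a *+ i = 0 -> a = 0.
Proof.
move=> hR /andP[i_gt0 i_lt] ai0.
have co : coprime i p.
  by rewrite coprime_sym prime_coprime ?(pcharf_prime hR) // gtnNdvd.
case: (egcdnP p i_gt0) => u v /= uv _.
have : a *+ (u * i) = 0 by rewrite mulnC mulrnA ai0 mul0rn.
rewrite uv mulrnDr (eqP co) mulr1n mulnC mulrnA.
by rewrite -(mulr_natr _ p) pcharf0 // mulr0 mul0rn add0r.
Qed.

Lemma jacobson (R : nzRingType) (f : {additive L -> R}) :
    p \in [pchar R] ->
    (forall x y, f (lie x y) = f x * f y - f y * f x) ->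
  forall x y, (f x + f y) ^+ p = f x ^+ p + f y ^+ p + f (jac x y).
Proof.
move=> hR fL x y.
have p_gt0 : (0 < p)%N by rewrite prime_gt0 // (pcharf_prime hp).
pose w : {poly R} := (f x)%:P * 'X + (f y)%:P.
have wP m : (w ^+ m)^`() = \sum_(i < m) w ^+ (m.-1 - i) * (f x)%:P * w ^+ i.
  elim: m => [|m IH]; first by rewrite expr0 big_ord0 derivC.
  rewrite exprSr derivM IH big_ord_recl /= subn0 expr0 mulr1 addrC.
  congr (_ + _).
    by congr (_ * _); rewrite derivD derivM !derivC derivX mul0r add0r mulr1
      addr0.
  rewrite mulr_suml; apply: eq_bigr => i _.
  rewrite -!mulrA -exprSr /bump /= add1n; congr (w ^+ _ * _).
  by case: (m) i => [|m'] i //; rewrite subSS.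
have coefJ m i : (iter_ad w (f x)%:P m)`_i = f (jac_coef x y m i).
  elim: m i => [|m IH] i /=; first by rewrite coefC; case: eqP; rewrite ?raddf0.
  set q := iter_ad _ _ _ in IH *.
  have -> : w * q - q * w = ((f x)%:P * q - q * (f x)%:P) * 'X
                            + ((f y)%:P * q - q * (f y)%:P).
    rewrite /w mulrDl mulrDr opprD addrACA mulrBl -!mulrA.
    by rewrite (commr_polyX q).
  rewrite coefD coefMX raddfD /=; congr (_ + _).
    case: i => [|i] /=; first by rewrite raddf0.
    by rewrite coefB coefCM coefMC IH fL.
  by rewrite coefB coefCM coefMC IH fL.
have coefw i : (0 < i < p)%N ->
    (w ^+ p)`_i = f ((i%:R^-1 : k) *: jac_coef x y p.-1 i.-1).
  move=> ip; apply/subr0_eq/(@mulrn_pchar_eq0 _ _ i) => //.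
  have i_neq0 : (i%:R : k) != 0.
    rewrite -(dvdn_pcharf hp); apply/negP => /dvdn_leq.
    by case/andP: ip => i_gt0 i_lt /(_ i_gt0); rewrite leqNgt i_lt.
  rewrite mulrnBl -raddfMn /= -scaler_nat scalerA mulfV // scale1r.
  rewrite -coefJ iter_ad_pchar ?pchar_poly // -wP coef_deriv.
  by case/andP: ip => i_gt0 _; rewrite prednK // subrr.
have size_w m : (size (w ^+ m) <= m.+1)%N.
  have size_w1 : (size w <= 2)%N.
    rewrite (leq_trans (size_polyD _ _)) // geq_max.
    rewrite (leq_trans (size_polyC_leq1 _)) // andbT.
    by rewrite (leq_trans (size_polyMleq _ _)) // size_polyX addn2 /=
      ltnS size_polyC_leq1.
  elim: m => [|m IH]; first by rewrite expr0 size_poly1.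
  rewrite exprS (leq_trans (size_polyMleq _ _)) //.
  by move: IH size_w1; lia.
have coef0w m : (w ^+ m)`_0 = f y ^+ m.
  elim: m => [|m IH]; first by rewrite !expr0 coef1.
  by rewrite !exprS coef0M IH {1}/w coefD coefMX /= coefC add0r.
have coeftw m : (w ^+ m)`_m = f x ^+ m.
  elim: m => [|m IH]; first by rewrite !expr0 coef1.
  rewrite !exprS {1}/w mulrDl -mulrA -(commr_polyX (w ^+ m)) mulrA coefD.
  rewrite coefMX /= !coefCM IH [_`_m.+1]nth_default ?mulr0 ?addr0 //.
have w1 : w.[1] = f x + f y by rewrite /w hornerD hornerMX !hornerC mulr1.
have comm1 (q : {poly R}) : comm_poly q 1 by rewrite /comm_poly mulr1 mul1r.
rewrite -w1 -horner_exp_comm // (horner_coef_wide _ (size_w p)).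
rewrite big_ord_recr /= coeftw expr1n mulr1.
rewrite -(big_mkord xpredT (fun i => (w ^+ p)`_i * 1 ^+ i)) big_ltn //=.
rewrite coef0w mulr1 addrC addrA; congr (_ + _).
rewrite /jac raddf_sum; apply: eq_big_nat => i ip.
by rewrite expr1n mulr1 coefw.
Qed.

End JacobsonFormula.
(******************************************************************************)
(* Centres, generated subalgebras, algebraic independence                     *)
(******************************************************************************)

Definition centre (A : pzRingType) : set A := [set x | forall y, x * y = y * x].
Arguments centre A : clear implicits.

Section Subalgebras.
Import mpoly.
Variables (k : comNzRingType) (A : algType k).

Inductive gen_subalg (S : set A) : A -> Prop :=
| SA_gen x : S x -> gen_subalg S x
| SA_one : gen_subalg S 1
| SA_add x y : gen_subalg S x -> gen_subalg S y -> gen_subalg S (x + y)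
| SA_scale a x : gen_subalg S x -> gen_subalg S (a *: x)
| SA_mul x y : gen_subalg S x -> gen_subalg S y -> gen_subalg S (x * y).

(* Meant for pairwise commuting x i: mpoly.mmap multiplies in index order.    *)
(* As a condition on the family it forces x to be injective.                  *)
Definition alg_independent (I : Type) (x : I -> A) : Prop :=
  forall (m : nat) (i : 'I_m -> I), injective i ->
  forall q : mpoly.mpoly m k, mpoly.mmap (in_alg A) (x \o i) q = 0 -> q = 0.

Definition freely_generated_by (I : Type) (x : I -> A) (B : set A) : Prop :=
  B = gen_subalg (range x) /\ alg_independent x.

End Subalgebras.

Section PCentre.
Variables (k : fieldType) (n : nat) (s : shift_matrix n) (p : nat).
Local Notation g := (shifted k s).
Local Notation U := (uenv g).

(* x^p - x^[p] *)
Definition p_elt (x : g) : U := uiota x ^+ p - uiota (sh_pmap p x).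

Lemma sh_pmapD (x y : g) : p \in [pchar k] ->
  sh_pmap p (x + y) = sh_pmap p x + sh_pmap p y + jac p x y.
Proof.
move=> hp; apply: val_inj; case: n s x y => [|m] s' x y.
  by apply/matrixP => -[].
have hM : p \in [pchar 'M[{poly k}]_m.+1].
  rewrite inE (pcharf_prime hp) /=.
  rewrite -(rmorph_nat (@scalar_mx {poly k} m.+1)) pcharf0 ?pchar_poly //.
  by rewrite raddf0.
pose f0 (x : shifted k s') : 'M[{poly k}]_m.+1 := shifted_val x.
have f0B : zmod_morphism f0 by [].
pose f : {additive _ -> _} :=
  HB.pack f0 (GRing.isZmodMorphism.Build _ _ f0 f0B).
exact: (@jacobson k _ p hp _ f hM (fun _ _ => erefl) x y).
Qed.

Lemma p_elt_semilinear (a : k) (x y : g) : p \in [pchar k] ->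
  p_elt (a *: x + y) = a ^+ p *: p_elt x + p_elt y.
Proof.
move=> hp; rewrite /p_elt sh_pmapD // !raddfD /=.
have hU : p \in [pchar U] by rewrite pchar_lalg.
rewrite (jacobson hp hU (@uiota_lie _ _)).
have -> : sh_pmap p (a *: x) = a ^+ p *: sh_pmap p x.
  apply: val_inj => /=; elim: (p) => [|q IH]; first by rewrite !expr0 scale1r.
  by rewrite !exprS IH -cur_scaleAl -cur_scaleAr scalerA.
rewrite !linearZ /= [uiota (a *: x)]linearZ /= exprZn.
by rewrite addrACA subrr addr0 addrACA.
Qed.

Definition p_centre : set U := gen_subalg (range p_elt).

(* 'I_n starts at 0, so the excluded pair (i,j) = (1,1) is (0,0) here.        *)
Inductive centre_index : Type :=
| CI_z of nat
| CI_p i j r of (s i j <= r)%N & ((i : nat, j : nat) != (0, 0))%N.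

Definition centre_gen (c : centre_index) : U :=
  match c with
  | CI_z r => uiota (sh_z k s r)
  | CI_p i j r sr _ =>
      uiota (sh_e k sr) ^+ p
      - (if i == j then uiota (sh_e_diag k s i (r * p)) else 0)
  end.

Lemma p_elt_e i j r (sr : (s i j <= r)%N) : p \in [pchar k] ->
  p_elt (sh_e k sr) = uiota (sh_e k sr) ^+ p
    - (if i == j then uiota (sh_e_diag k s i (r * p)) else 0).
Proof.
by move=> hp; rewrite /p_elt sh_pmap_e //; case: eqP => // _; rewrite raddf0.
Qed.

End PCentre.

Arguments p_centre k {n} s p _.
Arguments centre_gen k {n s} p c.

(* Main.v *)
Require Import Defs.
From HB Require Import structures.
From mathcomp Require Import all_boot all_order all_algebra.
From mathcomp Require Import boolp classical_sets.
From mathcomp Require Import finmap monalg ring zify.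
From mathcomp Require mpoly.

Set Implicit Arguments.
Unset Strict Implicit.
Unset Printing Implicit Defensive.

Import GRing.Theory.
Local Open Scope classical_set_scope.
Local Open Scope ring_scope.

(* The bracket of g_sigma is the commutator of the associative product of     *)
(* matrices. For such a Lie algebra L the symmetric algebra S(L) carries a    *)
(* representation of L in which a acts by a + D_a, where D_a is the           *)
(* derivation of S(L) extending left multiplication by a. The map phi(u) =    *)
(* u.1 from U(L) to S(L) preserves leading terms, whence PBW and the          *)
(* injectivity of phi; and since the adjoint derivations P_a satisfy [P_a, b  *)
(* + D_b] = [a,b] + D_[a,b], phi intertwines the adjoint actions exactly, so  *)
(* it maps Z(U(L)) into the invariants of S(L).                               *)
(*                                                                            *)
(* If f in S(g_sigma) is invariant, choose N so large that no e_{i,j} t^r     *)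
(* with r >= N occurs in f. Commuting P_a, for a = e_{i,j} t^N, with the      *)
(* partial derivatives in the directions e_{l,m} t^(N+r), all of which kill   *)
(* f, shows that the derivatives of f in the e_{i,j} t^r with i <> j vanish   *)
(* and those in the e_{i,i} t^r do not depend on i. Thus f is a polynomial in *)
(* the z_r and the p-th powers, each monomial of which is the leading term of *)
(* a product of the proposed generators; induction on the degree shows that   *)
(* these generate the centre, and distinctness of leading terms that they are *)
(* independent.                                                               *)

(** * The algebra of linear endomorphisms *)

(** Everything is read off from [phi], u |-> u.1, which needs no division by factorials and so works
    in characteristic p. The associative product on L turns [act] into a representation ([act_lie]),
    and [rho_commutator] says that [phi] carries ad x to the derivation [adj x]; hence central
    elements give invariants ([centre_invariant]). An element of U has symbol X^m when it acts as
    multiplication by X^m up to lower degree. Ordered products of basis elements have distinct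
    symbols and span U, so [phi] is injective ([phi_inj]).

    By [centre_generated] it then suffices to realise every monomial occurring in an invariant as
    the symbol of a product of central elements. For g_sigma, [invariant_pder] shows that the
    partial derivatives of an invariant vanish except along the z_r. In characteristic p the
    exponents of all other variables are thus divisible by p, and such monomials are exactly the
    products of the symbols of the generators ([cgen_symbol], [invariant_symbol]). These symbols are
    powers of distinct variables, whence freeness ([symbol_alg_independent]). The generators z_r are
    scalar matrices; the others are central because ad(x)^p = ad(x^p), both in U and for
    matrices. *)

Section Endomorphisms.
Variables (k : comNzRingType) (V : lmodType k).

(** The target algebra for [uenv_universal]: a representation of L is a bracket-preserving linear
    map into it. *)
Record endo := Endo { endo_fun :> V -> V; endo_linear : linear endo_fun }.

Lemma endoP (f g : endo) : f =1 g -> f = g.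
Proof.
case: f g => [f lf] [g lg] /= /funext fg; subst g.
by congr Endo; exact: Prop_irrelevance.
Qed.

HB.instance Definition _ := gen_eqMixin endo.
HB.instance Definition _ := gen_choiceMixin endo.
HB.instance Definition _ (f : endo) :=
  GRing.isLinear.Build k V V *:%R (endo_fun f) (endo_linear f).

Lemma endo_lin (f : endo) a x y : f (a *: x + y) = a *: f x + f y.
Proof. exact: endo_linear. Qed.

Lemma endo_addE (f : endo) x y : f (x + y) = f x + f y.
Proof. exact: raddfD. Qed.

Lemma endo_0 (f : endo) : f 0 = 0.
Proof. exact: raddf0. Qed.

Lemma endo_scaleE (f : endo) a x : f (a *: x) = a *: f x.
Proof. exact: linearZ. Qed.

Lemma endo_sumE (f : endo) (T : Type) (r : seq T) (F : T -> V) :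
  f (\sum_(x <- r) F x) = \sum_(x <- r) f (F x).
Proof. exact: raddf_sum. Qed.

Definition endo_of (f : {linear V -> V}) : endo := Endo (linearP f).

Definition endo_zero := endo_of \0.
Definition endo_add (f g : endo) := endo_of (f \+ g).
Definition endo_opp (f : endo) := endo_of (\- f).
Definition endo_one := endo_of idfun.
Definition endo_mul (f g : endo) := endo_of (f \o g).
Definition endo_scale (a : k) (f : endo) := endo_of (a \*: f).

Lemma endo_addA : associative endo_add.
Proof. by move=> f g h; apply: endoP => x /=; rewrite addrA. Qed.

Lemma endo_addC : commutative endo_add.
Proof. by move=> f g; apply: endoP => x /=; rewrite addrC. Qed.

Lemma endo_add0 : left_id endo_zero endo_add.
Proof. by move=> f; apply: endoP => x /=; rewrite add0r. Qed.

Lemma endo_addN : left_inverse endo_zero endo_opp endo_add.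
Proof. by move=> f; apply: endoP => x /=; rewrite addNr. Qed.

HB.instance Definition _ :=
  GRing.isZmodule.Build endo endo_addA endo_addC endo_add0 endo_addN.

Lemma endo_mulA : associative endo_mul.
Proof. by move=> f g h; exact: endoP. Qed.

Lemma endo_mul1l : left_id endo_one endo_mul.
Proof. by move=> f; exact: endoP. Qed.

Lemma endo_mul1r : right_id endo_one endo_mul.
Proof. by move=> f; exact: endoP. Qed.

Lemma endo_mulDl : left_distributive endo_mul endo_add.
Proof. by move=> f g h; exact: endoP. Qed.

Lemma endo_mulDr : right_distributive endo_mul endo_add.
Proof. by move=> f g h; apply: endoP => x /=; rewrite raddfD. Qed.

End Endomorphisms.

Section EndomorphismAlgebra.
Variables (k : comNzRingType) (V : lalgType k).
Local Notation E := (endo V).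

Lemma endo_one_neq0 : endo_one V != 0 :> E.
Proof.
apply/eqP => /(congr1 (fun f : E => f 1)) /= /eqP.
by apply/negP; exact: oner_neq0.
Qed.

HB.instance Definition _ := GRing.Zmodule_isNzRing.Build E
  (@endo_mulA k V) (@endo_mul1l k V) (@endo_mul1r k V) (@endo_mulDl k V)
  (@endo_mulDr k V) endo_one_neq0.

Lemma endo_scaleA a b (f : E) :
  endo_scale a (endo_scale b f) = endo_scale (a * b) f.
Proof. by apply: endoP => x /=; rewrite scalerA. Qed.

Lemma endo_scale1 : left_id 1 (@endo_scale k V).
Proof. by move=> f; apply: endoP => x /=; rewrite scale1r. Qed.

Lemma endo_scaleDr : right_distributive (@endo_scale k V) +%R.
Proof. by move=> a f g; apply: endoP => x /=; rewrite scalerDr. Qed.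

Lemma endo_scaleDl (f : E) a b :
  endo_scale (a + b) f = endo_scale a f + endo_scale b f.
Proof. by apply: endoP => x /=; rewrite scalerDl. Qed.

HB.instance Definition _ := GRing.Zmodule_isLmodule.Build k E
  endo_scaleA endo_scale1 endo_scaleDr endo_scaleDl.

Lemma endo_scaleAl (a : k) (f g : E) : a *: (f * g) = (a *: f) * g.
Proof. exact: endoP. Qed.

HB.instance Definition _ := GRing.Lmodule_isLalgebra.Build k E endo_scaleAl.

Lemma endo_scaleAr (a : k) (f g : E) : a *: (f * g) = f * (a *: g).
Proof. by apply: endoP => x /=; rewrite linearZ. Qed.

HB.instance Definition _ := GRing.Lalgebra_isAlgebra.Build k E endo_scaleAr.

Lemma endoDE (f g : E) x : (f + g) x = f x + g x.
Proof. by []. Qed.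

Lemma endoBE (f g : E) x : (f - g) x = f x - g x.
Proof. by []. Qed.

Lemma endoZE (a : k) (f : E) x : (a *: f) x = a *: f x.
Proof. by []. Qed.

Lemma endoME (f g : E) x : (f * g) x = f (g x).
Proof. by []. Qed.

End EndomorphismAlgebra.

(** * Polynomials in an arbitrary set of variables *)

Section Words.
Variable I : choiceType.
Implicit Types (m : {cmonom I}) (i : I) (w : seq I).

Local Notation "m1 *m m2" := (@mmul {cmonom I} m1 m2)
  (at level 40, left associativity).

(** A chosen ordering of the letters of [m], needed for noncommutative products; [wordcm] forgets
    the order, and [cmword] is a section of it. *)
Definition cmword m : seq I := flatten [seq nseq (m i) i | i <- finsupp m].

Definition wordcm w : {cmonom I} := \big[@mmul _/@mone _]_(i <- w) ucm i.

Lemma wordcm_cons i w : wordcm (i :: w) = ucm i *m wordcm w.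
Proof. by rewrite /wordcm big_cons. Qed.

Lemma wordcmE w i : wordcm w i = count_mem i w.
Proof.
elim: w => [|j w IH]; first by rewrite /wordcm big_nil cm1.
by rewrite wordcm_cons cmM IH cmU.
Qed.

Lemma count_cmword m i : count_mem i (cmword m) = m i.
Proof.
rewrite count_flatten sumnE !big_map.
transitivity (\sum_(j <- finsupp m) (j == i) * m j)%N.
  by apply: eq_bigr => j _; rewrite count_nseq.
case: (boolP (i \in finsupp m)) => im.
  rewrite (bigD1_seq i) ?fset_uniq //= eqxx mul1n big1 ?addn0 //.
  by move=> j /negPf ->.
rewrite big1_seq; last first.
  by move=> j /andP[_ jm]; case: eqP jm im => // -> ->.
by apply/esym/eqP; rewrite cmE_eq0.
Qed.

Lemma cmwordK m : wordcm (cmword m) = m.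
Proof. by apply/eqP/cmP => i; rewrite wordcmE count_cmword. Qed.

Lemma perm_wordcm w w' : (wordcm w == wordcm w') = perm_eq w w'.
Proof.
apply/eqP/idP => [ww'|]; last by move=> p; exact: perm_big.
by apply/allP => i _ /=; rewrite -!wordcmE ww'.
Qed.

Lemma cmonom_ind (P : {cmonom I} -> Prop) :
  P (@mone _) -> (forall i m, P m -> P (ucm i *m m)) -> forall m, P m.
Proof.
move=> P1 PM m; rewrite -(cmwordK m); elim: (cmword m) => [|i w IH].
  by rewrite /wordcm big_nil.
by rewrite wordcm_cons; exact: PM.
Qed.

Lemma mdeg_wordcm w : mdeg (wordcm w) = size w.
Proof.
elim: w => [|i w IH]; first by rewrite /wordcm big_nil mdeg1.
by rewrite wordcm_cons mdegM mdegU IH.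
Qed.

Lemma perm_cmwordM m1 m2 :
  perm_eq (cmword (m1 *m m2)) (cmword m1 ++ cmword m2).
Proof.
by apply/allP => i _ /=; rewrite count_cat !count_cmword cmM.
Qed.

End Words.

(* Working over an abstract record rather than {malg k[{cmonom I}]} keeps     *)
(* unification from unfolding the convolution product.                        *)
Record polyAlg (k : comNzRingType) (I : choiceType) := PolyAlg {
  poly_alg :> comAlgType k;
  mX : {cmonom I} -> poly_alg;
  mcf : {cmonom I} -> poly_alg -> k;
  supp : poly_alg -> seq {cmonom I};
  mX1 : mX mone = 1;
  mXM : forall m m', mX (mmul m m') = mX m * mX m';
  mcf_lin : forall m a f g, mcf m (a *: f + g) = a * mcf m f + mcf m g;
  mcf_mX : forall m m', mcf m' (mX m) = (m == m')%:R;
  supp_uniq : forall f, uniq (supp f);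
  mcf_supp : forall f m, (m \in supp f) = (mcf m f != 0);
  mX_expand : forall f, f = \sum_(m <- supp f) mcf m f *: mX m
}.

Section MalgPolyAlg.
Variables (k : comNzRingType) (I : choiceType).
Local Notation S := {malg k[{cmonom I}]}.

Definition malg_mX (m : {cmonom I}) : S := mkmalgU m 1.

Lemma malg_mXM m m' : malg_mX (mmul m m') = malg_mX m * malg_mX m'.
Proof. by rewrite malgM_def fgmulUU mulr1. Qed.

Lemma malg_mcf_lin m a (f g : S) :
  mcoeff m (a *: f + g) = a * mcoeff m f + mcoeff m g.
Proof. by rewrite mcoeffD mcoeffZ. Qed.

Lemma malg_expand (f : S) : f = \sum_(m <- msupp f) mcoeff m f *: malg_mX m.
Proof.
rewrite {1}[f]monalgE; apply: eq_bigr => m _.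
by apply/malgP => m'; rewrite mcoeffU mcoeffZ /malg_mX mcoeffU1 mulr_natr.
Qed.

Definition malg_polyAlg : polyAlg k I :=
  @PolyAlg k I S malg_mX (fun m f => mcoeff m f) (fun f => msupp f)
    erefl malg_mXM malg_mcf_lin (fun m m' => mcoeffU1 _ m m')
    (fun f => fset_uniq (msupp f)) (fun f m => esym (mcoeff_neq0 f m))
    malg_expand.

End MalgPolyAlg.

Section Polynomials.
Variables (k : comNzRingType) (I : choiceType) (S : polyAlg k I).
Implicit Types (m : {cmonom I}) (f g : S).

Definition var i : S := mX S (ucm i).

HB.instance Definition _ m := GRing.isLinear.Build k S k *%R (@mcf k I S m)
  (@mcf_lin k I S m).

Lemma mcf0 m : mcf m (0 : S) = 0.
Proof. exact: raddf0. Qed.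

Lemma mcfD m f g : mcf m (f + g) = mcf m f + mcf m g.
Proof. exact: raddfD. Qed.

Lemma mcfB m f g : mcf m (f - g) = mcf m f - mcf m g.
Proof. exact: raddfB. Qed.

Lemma mcfZ m a f : mcf m (a *: f) = a * mcf m f.
Proof. exact: linearZ. Qed.

Lemma mcf_sum m (T : Type) (r : seq T) (F : T -> S) :
  mcf m (\sum_(x <- r) F x) = \sum_(x <- r) mcf m (F x).
Proof. exact: raddf_sum. Qed.

Lemma mcf_eq0 f : (forall m, mcf m f = 0) -> f = 0.
Proof.
by move=> f0; rewrite (mX_expand f) big1 // => m _; rewrite f0 scale0r.
Qed.

Lemma polyAlg_lin_ind (P : S -> Prop) :
    (forall m, P (mX S m)) -> (forall a f g, P f -> P g -> P (a *: f + g)) ->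
  forall f, P f.
Proof.
move=> PX PD f; rewrite (mX_expand f).
elim: (supp f) => [|m s IH]; last first.
  by rewrite big_cons; apply: PD; [exact: PX | exact: IH].
by rewrite big_nil -(subrr (mX S mone)) addrC -scaleN1r; exact: PD.
Qed.

Lemma polyAlg_ind (P : S -> Prop) :
    P 1 -> (forall i f, P f -> P (var i * f)) ->
    (forall a f g, P f -> P g -> P (a *: f + g)) ->
  forall f, P f.
Proof.
move=> P1 PX; apply: polyAlg_lin_ind; apply: cmonom_ind => [|i m Pm].
  by rewrite mX1.
by rewrite mXM; exact: PX.
Qed.

Section LinearExtension.
Variables (V : lmodType k) (h : {cmonom I} -> V).

Definition lext f : V := \sum_(m <- supp f) mcf m f *: h m.

(** Allows the sums for several polynomials to run over one common list, which gives linearity. *)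
Lemma lextEw (d : seq {cmonom I}) f : uniq d -> {subset supp f <= d} ->
  lext f = \sum_(m <- d) mcf m f *: h m.
Proof.
move=> ud sd; rewrite (bigID (mem (supp f))) /= [X in _ + X]big1 ?addr0.
  rewrite -big_filter; apply: perm_big; apply: uniq_perm.
  - exact: supp_uniq.
  - exact: filter_uniq.
  - by move=> m; rewrite mem_filter /=; case: (boolP (m \in supp f)) => // /sd.
by move=> m; rewrite mcf_supp negbK => /eqP ->; rewrite scale0r.
Qed.

Lemma lext_is_linear : linear lext.
Proof.
move=> a f g; pose d := undup (supp f ++ supp g ++ supp (a *: f + g)).
have dP h' : {subset supp h' <= supp f ++ supp g ++ supp (a *: f + g)} ->
    lext h' = \sum_(m <- d) mcf m h' *: h m.
  move=> sh; apply: lextEw; first exact: undup_uniq.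
  by move=> m /sh; rewrite mem_undup.
rewrite !dP; try by move=> m mS; rewrite !mem_cat mS ?orbT.
rewrite scaler_sumr -big_split /=; apply: eq_bigr => m _.
by rewrite mcf_lin scalerDl scalerA.
Qed.

HB.instance Definition _ :=
  GRing.isLinear.Build k S V *:%R lext lext_is_linear.

Lemma lext_mX m : lext (mX S m) = h m.
Proof.
rewrite (@lextEw [:: m]) // => [|m']; first last.
  rewrite mcf_supp mcf_mX inE [m' == m]eq_sym.
  by case: (m == m') => //; rewrite eqxx.
by rewrite big_seq1 mcf_mX eqxx scale1r.
Qed.

End LinearExtension.

End Polynomials.

Arguments var {k I} S i.

(** * Degree and derivations *)

Section Degree.
Variables (k : comNzRingType) (I : choiceType).
Variable S : polyAlg k I.
Implicit Types (m : {cmonom I}) (f g : S).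

(** The bound is strict, so [deg_lt 0] singles out the zero polynomial and inductions on the degree
    can end there. *)
Definition deg_lt d f : Prop := forall m, (d <= mdeg m)%N -> mcf m f = 0.

Lemma deg_lt_ex f : exists d, deg_lt d f.
Proof.
exists (\max_(m <- supp f) (mdeg m).+1)%N => m dm; apply/eqP/negPn.
rewrite -mcf_supp; apply/negP => mf.
by move: dm; rewrite leqNgt (leq_bigmax_seq _ mf).
Qed.

Lemma deg_lt0 d : deg_lt d 0.
Proof. by move=> m _; rewrite mcf0. Qed.

Lemma deg_lt_eq0 f : deg_lt 0 f -> f = 0.
Proof. by move=> f0; apply: mcf_eq0 => m; exact: f0. Qed.

Lemma deg_ltD d f g : deg_lt d f -> deg_lt d g -> deg_lt d (f + g).
Proof. by move=> df dg m dm; rewrite mcfD df // dg // addr0. Qed.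

Lemma deg_ltZ d a f : deg_lt d f -> deg_lt d (a *: f).
Proof. by move=> df m dm; rewrite mcfZ df // mulr0. Qed.

Lemma deg_ltB d f g : deg_lt d f -> deg_lt d g -> deg_lt d (f - g).
Proof. by move=> df dg m dm; rewrite mcfB df // dg // subr0. Qed.

Lemma deg_lt_le d e f : (d <= e)%N -> deg_lt d f -> deg_lt e f.
Proof. by move=> de df m em; apply: df; exact: leq_trans em. Qed.

Lemma deg_lt_sum d (T : eqType) (r : seq T) (F : T -> S) :
  (forall x, x \in r -> deg_lt d (F x)) -> deg_lt d (\sum_(x <- r) F x).
Proof.
move=> dF; rewrite big_seq; elim/big_ind: _ => [|f g|x].
- exact: deg_lt0.
- exact: deg_ltD.
- exact: dF.
Qed.

Lemma deg_lt_mX d m : (mdeg m < d)%N -> deg_lt d (mX S m).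
Proof.
move=> md m' dm'; rewrite mcf_mX; case: eqP => // mm'.
by move: dm'; rewrite -mm' leqNgt md.
Qed.

Lemma deg_lt_supp d f m : deg_lt d f -> m \in supp f -> (mdeg m < d)%N.
Proof.
by move=> df; rewrite mcf_supp ltnNge; apply: contraNN => /df ->.
Qed.

Lemma deg_ltMl d e f g :
  deg_lt d.+1 f -> deg_lt e g -> deg_lt (d + e) (f * g).
Proof.
move=> df dg; rewrite (mX_expand f) (mX_expand g) mulr_suml.
apply: deg_lt_sum => m mf; rewrite mulr_sumr.
apply: deg_lt_sum => m' mg; rewrite -scalerAl -scalerAr -mXM.
apply: deg_ltZ; apply: deg_ltZ; apply: deg_lt_mX.
rewrite mdegM -addnS leq_add //; last exact: deg_lt_supp mg.
by rewrite -ltnS; exact: deg_lt_supp mf.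
Qed.

Lemma deg_ltM d e f g :
  deg_lt d.+1 f -> deg_lt e.+1 g -> deg_lt (d + e).+1 (f * g).
Proof. by rewrite -addnS; exact: deg_ltMl. Qed.

End Degree.

Section Derivations.
Variables (k : comNzRingType) (S : comAlgType k).
Implicit Types (f g x : S) (d e : endo S).

Definition is_der d : Prop := forall f g, d (f * g) = d f * g + f * d g.

Lemma is_der1 d : is_der d -> d 1 = 0.
Proof.
move=> dP; apply: (addrI (d 1)).
by rewrite addr0 -{3}(mulr1 1) dP mulr1 mul1r.
Qed.

Lemma is_der_commutator d e : is_der d -> is_der e -> is_der (d * e - e * d).
Proof.
move=> dP eP f g; rewrite !endoBE !endoME dP eP !raddfD /= !dP !eP.
by ring.
Qed.

Lemma is_derD d e : is_der d -> is_der e -> is_der (d + e).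
Proof. by move=> dP eP f g; rewrite !endoDE dP eP; ring. Qed.

Lemma is_derZ a d : is_der d -> is_der (a *: d).
Proof.
by move=> dP f g; rewrite !endoZE dP scalerDr scalerAl scalerAr.
Qed.

End Derivations.

Section PolynomialDerivations.
Variables (k : comNzRingType) (I : choiceType).
Variable S : polyAlg k I.
Local Notation "m1 *m m2" := (@mmul {cmonom I} m1 m2)
  (at level 40, left associativity).
Implicit Types (m : {cmonom I}) (f g : S) (d e : endo S) (v : I -> S).

Lemma is_der_ext d e : is_der d -> is_der e ->
  (forall i, d (var S i) = e (var S i)) -> d = e.
Proof.
move=> dP eP de; apply: endoP => f.
elim/polyAlg_ind: f => [|i f IH|a f g fP gP].
- by rewrite (is_der1 dP) (is_der1 eP).
- by rewrite dP eP de IH.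
- by rewrite !endo_lin fP gP.
Qed.

(** The relation 'X^2 = 0 of dual numbers is not imposed, since only the coefficients 0 and 1 are
    read. *)
Definition dual_mX v m : {poly poly_alg S} :=
  \prod_(i <- cmword m) ((var S i)%:P + v i *: 'X).

Lemma dual_mXM v m1 m2 : dual_mX v (m1 *m m2) = dual_mX v m1 * dual_mX v m2.
Proof. by rewrite /dual_mX (perm_big _ (perm_cmwordM m1 m2)) big_cat. Qed.

Lemma dual_mXU v i : dual_mX v (ucm i) = (var S i)%:P + v i *: 'X.
Proof.
have p : perm_eq (cmword (ucm i)) [:: i].
  by apply/allP => j _ /=; rewrite count_cmword cmU addn0.
by rewrite /dual_mX (perm_big _ p) big_seq1.
Qed.

Lemma dual_mX1 v : dual_mX v (@mone _) = 1.
Proof.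
have p : perm_eq (cmword (@mone {cmonom I})) [::].
  by apply/allP => j _ /=; rewrite count_cmword cm1.
by rewrite /dual_mX (perm_big _ p) big_nil.
Qed.

Lemma coef0_dual_mX v m : (dual_mX v m)`_0 = mX S m.
Proof.
elim/cmonom_ind: m => [|i m IH]; first by rewrite dual_mX1 coef1 mX1.
rewrite dual_mXM coef0M IH dual_mXU coefD coefC coefZ coefX /= mulr0 addr0.
by rewrite mXM.
Qed.

(* The derivation with values v on the variables, read off the coefficient of *)
(* the dual number in the substitution X_i -> X_i + v_i 'X.                   *)
Fact der_key : unit. Proof. exact: tt. Qed.
Definition der v : endo S :=
  locked_with der_key (endo_of (lext (fun m => (dual_mX v m)`_1))).

Lemma der_mX v m : der v (mX S m) = (dual_mX v m)`_1.
Proof. by rewrite /der unlock; exact: lext_mX. Qed.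

Lemma der_var v i : der v (var S i) = v i.
Proof.
rewrite der_mX dual_mXU coefD coefC coefZ coefX /= mulr1.
by rewrite add0r.
Qed.

Lemma der_is_der v : is_der (der v).
Proof.
move=> f g; elim/polyAlg_lin_ind: f => [m|a f f' IH IH']; last first.
  rewrite mulrDl -scalerAl !endo_lin IH IH' !mulrDl -!scalerAl scalerDr.
  by rewrite addrACA.
elim/polyAlg_lin_ind: g => [m'|a f f' IH IH']; last first.
  rewrite mulrDr -scalerAr !endo_lin IH IH' !mulrDr -!scalerAr scalerDr.
  by rewrite addrACA.
rewrite -mXM !der_mX dual_mXM coefM !big_ord_recl big_ord0 /= !coef0_dual_mX.
by rewrite addr0 addrC.
Qed.

Lemma deg_lt_der v n f : (forall i, deg_lt 2 (v i)) ->
  deg_lt n.+1 f -> deg_lt n.+1 (der v f).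
Proof.
move=> dv df; rewrite {1}(mX_expand f) endo_sumE; apply: deg_lt_sum => m mf.
rewrite endo_scaleE; apply: deg_ltZ.
apply: (@deg_lt_le _ _ _ (mdeg m).+1); first exact: deg_lt_supp mf.
elim/cmonom_ind: {mf} m => [|i m IH].
  by rewrite mX1 (is_der1 (@der_is_der v)); exact: deg_lt0.
rewrite mXM der_is_der -/(var S i) der_var mdegM mdegU; apply: deg_ltD.
  by apply: deg_ltM => //; exact: deg_lt_mX.
by apply: deg_ltM => //; apply: deg_lt_mX; rewrite mdegU.
Qed.

Definition pder i : endo S := der (fun j => (j == i)%:R).

Lemma pder_is_der i : is_der (pder i).
Proof. exact: der_is_der. Qed.

Lemma pder_var i j : pder i (var S j) = (j == i)%:R.
Proof. exact: der_var. Qed.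

Lemma euler_mX i m : var S i * pder i (mX S m) = (m i)%:R *: mX S m.
Proof.
elim/cmonom_ind: m => [|j m IH].
  by rewrite mX1 (is_der1 (@pder_is_der i)) mulr0 cm1 scale0r.
rewrite mXM pder_is_der -/(var S j) pder_var mulrDr [X in _ + X]mulrCA IH.
rewrite cmM cmU natrD scalerDl -scalerAr; congr (_ + _).
by case: eqP => [->|_]; rewrite ?mul1r ?scale1r // mul0r mulr0 scale0r.
Qed.

(** The operator X_i d/dX_i is diagonal on monomials, with eigenvalue [m i]. In characteristic p
    this forces p to divide [m i] on the support. *)
Lemma pder0_supp i f m :
  pder i f = 0 -> m \in supp f -> (m i)%:R * mcf m f = 0.
Proof.
move=> f0 mf; have : mcf m (var S i * pder i f) = 0 by rewrite f0 mulr0 mcf0.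
rewrite [X in pder i X](mX_expand f) endo_sumE mulr_sumr mcf_sum.
rewrite (bigD1_seq m) //=.
  rewrite endo_scaleE -scalerAr euler_mX !mcfZ mcf_mX eqxx mulr1 big1 ?addr0.
    by rewrite mulrC.
  move=> m' /negPf mm'; rewrite endo_scaleE -scalerAr euler_mX !mcfZ mcf_mX.
  by rewrite mm' !mulr0.
exact: supp_uniq.
Qed.

End PolynomialDerivations.

(** * The representation on the symmetric algebra *)

Section MulEndo.
Variables (k : comNzRingType) (S : comAlgType k).

Lemma emul_linear (f : S) : linear ( *%R f).
Proof. by move=> a x y; rewrite mulrDr scalerAr. Qed.

Definition emul (f : S) : endo S := Endo (emul_linear f).

Lemma emulE (f g : S) : emul f g = f * g.
Proof. by []. Qed.

End MulEndo.

(* io identifies L with the homogeneous polynomials of degree 1 in S.         *)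
Record lieBasis (k : comNzRingType) (L : lieAlgType k) (I : choiceType)
    (S : polyAlg k I) := LieBasis {
  lmul : L -> L -> L;
  lmul_linl : forall z, linear (lmul^~ z);
  lmul_linr : forall z, linear (lmul z);
  lmulA : associative lmul;
  lieE : forall x y, lie x y = lmul x y - lmul y x;
  bas :> I -> L;
  io : L -> S;
  io_linear : linear io;
  io_bas : forall i, io (bas i) = var S i;
  bas_span : forall x, lin_span (range bas) x
}.

Section Representation.
Variables (k : comNzRingType) (L : lieAlgType k) (I : choiceType).
Variables (S : polyAlg k I) (b : lieBasis L S).
Local Notation U := (uenv L).
Local Notation io := (io b).
Local Notation mul := (lmul b).

HB.instance Definition _ :=
  GRing.isLinear.Build k L S *:%R io (@io_linear k L I S b).
HB.instance Definition _ z :=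
  GRing.isLinear.Build k L L *:%R (mul z) (@lmul_linr k L I S b z).

Lemma mulBl x y z : mul (x - y) z = mul x z - mul y z.
Proof.
by have := lmul_linl b z (-1) y x; rewrite !scaleN1r ![- _ + _]addrC.
Qed.

Definition ddir (w : L -> S) : endo S := der (fun i => w (b i)).

Lemma ddir_is_der w : is_der (ddir w).
Proof. exact: der_is_der. Qed.

Lemma ddir_io w x : linear w -> ddir w (io x) = w x.
Proof.
move=> lw; pose l := GRing.isLinear.Build k L S *:%R w lw.
pose w' : {linear L -> S} := HB.pack w l.
rewrite -[w x]/(w' x) -[w]/(w' : L -> S); elim: (bas_span b x).
- by move=> _ [i _ <-]; rewrite io_bas der_var.
- by rewrite !raddf0.
- by move=> {}x y _ IHx _ IHy; rewrite !raddfD /= IHx IHy.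
- by move=> a {}x _ IH; rewrite !linearZ /= IH.
Qed.

(** Reduces identities between derivations of S to checks on the copy [io] of L. *)
Lemma ddir_ext w d : linear w -> is_der d -> (forall x, d (io x) = w x) ->
  d = ddir w.
Proof.
move=> lw dP dw; apply: is_der_ext => // [|i]; first exact: ddir_is_der.
by rewrite -(io_bas b) dw ddir_io.
Qed.

Definition ldir (a : L) : endo S := ddir (fun x => io (mul a x)).

Lemma ldir_lin a : linear (fun x => io (mul a x)).
Proof. by move=> c x y; rewrite !linearP. Qed.

Lemma ldir_io a x : ldir a (io x) = io (mul a x).
Proof. exact/ddir_io/ldir_lin. Qed.

Definition act (a : L) : endo S := emul (io a) + ldir a.

Lemma actE a f : act a f = io a * f + ldir a f.
Proof. by []. Qed.

Lemma act_linear : linear act.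
Proof.
move=> c x y; rewrite /act scalerDr addrACA; congr (_ + _).
  by apply: endoP => f; rewrite endoDE endoZE !emulE linearP mulrDl scalerAl.
symmetry; apply: ddir_ext; first exact: ldir_lin.
  by apply: is_derD; [apply: is_derZ|]; exact: ddir_is_der.
move=> z; rewrite endoDE endoZE !ldir_io -linearP; congr io.
by symmetry; exact: lmul_linl.
Qed.

HB.instance Definition _ := GRing.isLinear.Build k L (endo S) *:%R act
  act_linear.

Lemma ldir_lie x y : ldir (lie x y) = ldir x * ldir y - ldir y * ldir x.
Proof.
symmetry; apply: ddir_ext; first exact: ldir_lin.
  by apply: is_der_commutator; exact: ddir_is_der.
move=> z; rewrite endoBE !endoME !ldir_io (lieE b) mulBl raddfB /=.
by rewrite !lmulA.
Qed.

(** The cross terms contribute [io] of xy - yx, which is the multiplication part of the right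
    operator; associativity makes the derivation parts match ([ldir_lie]). *)
Lemma act_lie x y : act (lie x y) = act x * act y - act y * act x.
Proof.
apply: endoP => f; rewrite endoBE !endoME !actE !endo_addE.
rewrite !(ddir_is_der _ (io _)) -!/(ldir _) !ldir_io ldir_lie endoBE !endoME.
by rewrite (lieE b) raddfB /=; ring.
Qed.

End Representation.

(** * Leading terms, PBW and the centre *)

Lemma uenv_gen (k : comNzRingType) (L : lieAlgType k) (u : uenv L) :
  gen_subalg (range (@uiota k L)) u.
Proof.
have gen0 : gen_subalg (range (@uiota k L)) 0.
  by rewrite -(scale0r 1); apply: SA_scale; exact: SA_one.
have [f ->] := quot_proj_surj u.
rewrite (fa_monomE f) linear_sum; elim/big_ind: _ => [//|x y|m _].
  exact: SA_add.
rewrite linearZ /=; apply: SA_scale.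
rewrite fa_monom_prod rmorph_prod; elim/big_ind: _ => [|x y|x _].
- exact: SA_one.
- exact: SA_mul.
- by apply: SA_gen; exists x.
Qed.

Section PBW.
Variables (k : fieldType) (L : lieAlgType k) (I : choiceType).
Variables (S : polyAlg k I) (b : lieBasis L S).
Local Notation io := (io b).

Variables (U : algType k) (iota : {linear L -> U}).
Hypothesis iota_lie : forall x y,
  iota (lie x y) = iota x * iota y - iota y * iota x.
Hypothesis iota_gen : forall u, gen_subalg (range iota) u.
Variable rho : {lrmorphism U -> endo S}.
Hypothesis rhoE : forall x, rho (iota x) = act b x.

(** * The map [phi] and the adjoint action *)

Definition phi (u : U) : S := rho u 1.

Lemma phi_linear : linear phi.
Proof. by move=> a u v; rewrite /phi linearP. Qed.

HB.instance Definition _ := GRing.isLinear.Build k U S *:%R phi phi_linear.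

Definition adj (x : L) : endo S := ddir b (fun y => io (lie x y)).

Lemma adj_is_der x : is_der (adj x).
Proof. exact: ddir_is_der. Qed.

Lemma adj_io x y : adj x (io y) = io (lie x y).
Proof.
apply: ddir_io => a u v.
by rewrite lie_linearr linearP.
Qed.

(** On degree one this is the Leibniz rule [x, yz] - y[x, z] = [x, y]z. *)
Lemma adj_act x y : adj x * act b y - act b y * adj x = act b (lie x y).
Proof.
have dE : adj x * ldir b y - ldir b y * adj x = ldir b (lie x y).
  apply: ddir_ext; first exact: ldir_lin.
    by apply: is_der_commutator; exact: ddir_is_der.
  move=> z; rewrite endoBE !endoME ldir_io !adj_io ldir_io -raddfB /=.
  congr io; rewrite !(lieE b) mulBl raddfB /= !(lmulA b).
  by rewrite opprB addrA addrNK.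
apply: endoP => f; rewrite endoBE !endoME !actE !endo_addE adj_is_der adj_io.
by rewrite -dE endoBE !endoME; ring.
Qed.

Lemma rho_commutator x u :
  rho (iota x * u - u * iota x) = adj x * rho u - rho u * adj x.
Proof.
elim: (iota_gen u) => {u} [_ [y _ <-]||u v _ IHu _ IHv|a u _ IHu
  |u v _ IHu _ IHv].
- by rewrite -iota_lie !rhoE adj_act.
- by rewrite mulr1 mul1r subrr raddf0 rmorph1 mulr1 mul1r subrr.
- rewrite mulrDl mulrDr opprD addrACA raddfD /= IHu IHv raddfD /= mulrDl mulrDr.
  by rewrite opprD addrACA.
- rewrite -scalerAl -scalerAr -scalerBr !linearZ /= IHu -scalerAl -scalerAr.
  by rewrite scalerBr.
- have -> : iota x * (u * v) - u * v * iota x =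
    (iota x * u - u * iota x) * v + u * (iota x * v - v * iota x).
    by rewrite mulrBl mulrBr !mulrA addrA addrNK.
  rewrite raddfD /= !rmorphM /= IHu IHv.
  by rewrite mulrBl mulrBr !mulrA addrA addrNK.
Qed.

(** Evaluate [rho_commutator] at 1, which the derivation [adj x] kills. *)
Lemma centre_invariant u x : centre U u -> adj x (phi u) = 0.
Proof.
move=> uC; have := congr1 (fun d : endo S => d 1) (rho_commutator x u).
rewrite uC subrr raddf0 endoBE !endoME (is_der1 (@adj_is_der x)) endo_0 subr0.
by move=> <-.
Qed.

(** Asking this for all [f], and not only for [f] = 1 as in [phi_symbol], makes symbols
    multiplicative. *)
Definition has_symbol (u : U) (m : {cmonom I}) : Prop :=
  forall n f, deg_lt n.+1 f -> deg_lt (n + mdeg m) (rho u f - mX S m * f).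

Lemma has_symbol_deg u m n f : has_symbol u m ->
  deg_lt n.+1 f -> deg_lt (n + mdeg m).+1 (rho u f).
Proof.
move=> um nf; rewrite -(subrK (mX S m * f) (rho u f)); apply: deg_ltD.
  by apply: deg_lt_le (um _ _ nf).
by rewrite addnC; apply: deg_ltM => //; exact: deg_lt_mX.
Qed.

Lemma has_symbolM u v m m' :
  has_symbol u m -> has_symbol v m' -> has_symbol (u * v) (mmul m m').
Proof.
move=> um vm n f nf; rewrite rmorphM endoME mXM mdegM.
rewrite -(subrK (mX S m * rho v f) (rho u (rho v f))) -addrA; apply: deg_ltD.
  rewrite (addnC (mdeg m)) addnA; apply: um.
  exact: has_symbol_deg.
rewrite -mulrA -mulrBr addnCA.
apply: deg_ltMl; last exact: vm.
by apply: deg_lt_mX.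
Qed.

Lemma has_symbol1 : has_symbol 1 mone.
Proof. by move=> n f _; rewrite rmorph1 mX1 mul1r subrr; exact: deg_lt0. Qed.

Lemma has_symbol_exp u t d e : has_symbol u (wordcm (nseq d t)) ->
  has_symbol (u ^+ e) (wordcm (nseq (e * d) t)).
Proof.
move=> um; elim: e => [|e IH].
  by rewrite /wordcm big_nil; exact: has_symbol1.
by rewrite exprS mulSn nseqD /wordcm big_cat; exact: has_symbolM.
Qed.

Lemma deg_lt_io x : deg_lt 2 (io x).
Proof.
elim: (bas_span b x) => {x} [_ [i _ <-]||x y _ IHx _ IHy|a x _ IH].
- by rewrite io_bas; apply: deg_lt_mX; rewrite mdegU.
- by rewrite raddf0; exact: deg_lt0.
- by rewrite raddfD /=; exact: deg_ltD.
- by rewrite linearZ /=; exact: deg_ltZ.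
Qed.

Lemma deg_lt_ldir n f x : deg_lt n.+1 f -> deg_lt n.+1 (ldir b x f).
Proof. by apply: deg_lt_der => i; exact: deg_lt_io. Qed.

Lemma has_symbol_bas i : has_symbol (iota (b i)) (ucm i).
Proof.
move=> n f nf; rewrite rhoE actE io_bas addrAC subrr add0r mdegU addn1.
exact: deg_lt_ldir.
Qed.

Lemma phi_symbol u m : has_symbol u m -> deg_lt (mdeg m) (phi u - mX S m).
Proof.
move=> um; rewrite -[mX S m]mulr1; apply: (um 0%N).
by rewrite -mX1; apply: deg_lt_mX; rewrite mdeg1.
Qed.

Lemma mcf_phi u m : has_symbol u m -> mcf m (phi u) = 1.
Proof.
move=> /phi_symbol/(_ m (leqnn _))/eqP; rewrite mcfB mcf_mX eqxx subr_eq0.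
by move/eqP.
Qed.

Lemma mcf_phi0 u m m' : has_symbol u m -> m != m' -> (mdeg m <= mdeg m')%N ->
  mcf m' (phi u) = 0.
Proof.
move=> /phi_symbol um /negPf mm' /um/eqP; rewrite mcfB mcf_mX mm' subr0.
by move/eqP.
Qed.

Lemma symbol_independent (T : eqType) (r : seq T) (c : T -> k) (u : T -> U)
    (nu : T -> {cmonom I}) :
    uniq r -> {in r &, injective nu} ->
    (forall x, x \in r -> has_symbol (u x) (nu x)) ->
    \sum_(x <- r) c x *: phi (u x) = 0 ->
  forall x, x \in r -> c x = 0.
Proof.
move=> ur nu_inj unu cu0.
(* Descending induction: once all coefficients at symbols of degree above d vanish, reading off the
   coefficient at a symbol of degree d isolates its own. *)
have [d] : exists d, forall x, x \in r -> (d <= mdeg (nu x))%N -> c x = 0.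
  exists (\max_(x <- r) (mdeg (nu x)).+1)%N => x xr.
  by rewrite leqNgt (leq_bigmax_seq _ xr).
elim: d => [|d IH] dP; first by move=> x xr; exact: dP.
apply: IH => x xr; rewrite leq_eqVlt => /orP[/eqP dx|]; last exact: dP.
have := congr1 (mcf (nu x)) cu0; rewrite mcf_sum mcf0 (bigD1_seq x) //=.
rewrite mcfZ mcf_phi ?mulr1; last exact: unu.
rewrite big1_seq ?addr0 // => y /andP[yx yr]; rewrite mcfZ.
have [yd|yd] := leqP d.+1 (mdeg (nu y)); first by rewrite dP // mul0r.
rewrite (mcf_phi0 (unu _ yr)) ?mulr0 //; last by rewrite -dx -ltnS.
by apply: contraNneq yx => /nu_inj ->.
Qed.

(** * The length filtration of U and PBW *)

Definition wprod (w : seq I) : U := \prod_(i <- w) iota (b i).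

Definition fil (d : nat) : set U :=
  lin_span [set u | exists2 w, (size w < d)%N & u = wprod w].

Lemma fil_le d e u : (d <= e)%N -> fil d u -> fil e u.
Proof.
move=> de; elim=> {u} [_ [w wd ->]||u v _ IHu _ IHv|a u _ IH].
- by apply: LS_gen; exists w => //; exact: leq_trans de.
- exact: LS_0.
- exact: LS_add.
- exact: LS_scale.
Qed.

Lemma fil_wprod w : fil (size w).+1 (wprod w).
Proof. by apply: LS_gen; exists w. Qed.

Lemma fil_iota x : fil 2 (iota x).
Proof.
elim: (bas_span b x) => {x} [_ [i _ <-]||x y _ IHx _ IHy|a x _ IH].
- by apply: LS_gen; exists [:: i] => //; rewrite /wprod big_seq1.
- by rewrite raddf0; exact: LS_0.
- by rewrite raddfD; exact: LS_add.
- by rewrite linearZ; exact: LS_scale.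
Qed.

(** The bound is a condition on lengths because [fil d] means length below d, and a formula d + e -
    1 would truncate at zero. *)
Lemma filM d e f u v :
    (forall c c', (c < d)%N -> (c' < e)%N -> (c + c' < f)%N) ->
  fil d u -> fil e v -> fil f (u * v).
Proof.
move=> def du ev; elim: du => {u} [_ [w wd ->]||u u' _ IHu _ IHu'|a u _ IH].
- elim: ev => {v} [_ [w' we ->]||v v' _ IHv _ IHv'|a v _ IH].
  + apply: LS_gen; exists (w ++ w'); last by rewrite /wprod big_cat.
    by rewrite size_cat def.
  + by rewrite mulr0; exact: LS_0.
  + by rewrite mulrDr; exact: LS_add.
  + by rewrite -scalerAr; exact: LS_scale.
- by rewrite mul0r; exact: LS_0.
- by rewrite mulrDl; exact: LS_add.
- by rewrite -scalerAl; exact: LS_scale.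
Qed.

Lemma fil_commutator_iota x w :
  fil (size w).+1 (iota x * wprod w - wprod w * iota x).
Proof.
elim: w => [|i w IH]; rewrite /wprod.
  by rewrite big_nil mulr1 mul1r subrr; exact: LS_0.
rewrite big_cons -/(wprod w).
have -> : iota x * (iota (b i) * wprod w) - iota (b i) * wprod w * iota x =
    iota (lie x (b i)) * wprod w
    + iota (b i) * (iota x * wprod w - wprod w * iota x).
  by rewrite iota_lie mulrBl mulrBr !mulrA addrA addrNK.
apply: LS_add.
  by apply: filM (fil_iota _) (fil_wprod w) => c c' /=; lia.
by apply: filM (fil_iota _) IH => c c' /=; lia.
Qed.

Lemma fil_commutator w w' :
  fil (size w + size w') (wprod w * wprod w' - wprod w' * wprod w).
Proof.
elim: w => [|i w IH]; rewrite /wprod.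
  by rewrite big_nil mulr1 mul1r subrr; exact: LS_0.
rewrite big_cons -/(wprod w) -/(wprod w').
have -> : iota (b i) * wprod w * wprod w' - wprod w' * (iota (b i) * wprod w) =
    iota (b i) * (wprod w * wprod w' - wprod w' * wprod w)
    + (iota (b i) * wprod w' - wprod w' * iota (b i)) * wprod w.
  by rewrite mulrBl mulrBr !mulrA addrA addrNK.
apply: LS_add.
  by apply: filM (fil_iota _) IH => c c' /=; lia.
by apply: filM (fil_commutator_iota _ _) (fil_wprod w) => c c' /=; lia.
Qed.

(** Permutations are generated by swaps of adjacent blocks, and each swap costs a commutator of
    smaller length. *)
Lemma fil_perm w w' : perm_eq w w' -> fil (size w) (wprod w - wprod w').
Proof.
move=> ww'; pose P w1 := size w1 = size w /\ fil (size w) (wprod w - wprod w1).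
suff [] : P w' by [].
apply: (catCA_perm_ind _ ww'); last first.
  by split=> //; rewrite subrr; exact: LS_0.
move=> s1 s2 s3 [s_w IH]; split; first by rewrite -s_w !size_cat addnCA.
rewrite -(subrKA (wprod (s1 ++ s2 ++ s3))); apply: LS_add => //.
rewrite /wprod !big_cat /= !mulrA -mulrBl -!/(wprod _).
apply: filM (fil_commutator _ _) (fil_wprod s3) => c c'.
by rewrite -s_w !size_cat; lia.
Qed.

(* An unnormalised symmetrisation: each monomial goes to one ordered product. *)
Definition symm : S -> U := lext (fun m => wprod (cmword m)).

(** The spanning half of PBW: put each product into its chosen order and absorb the shorter error
    terms by induction. *)
Lemma symm_surj u : exists f, u = symm f.
Proof.
suff [d du] : exists d, fil d u.
  elim: d u du => [|d IHd] u.
    elim=> {u} [u []//||u v _ [f ->] _ [g ->]|a u _ [f ->]].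
    - by exists 0; rewrite /symm raddf0.
    - by exists (f + g); rewrite /symm raddfD.
    - by exists (a *: f); rewrite /symm linearZ.
  elim=> {u} [_ [w wd ->]||u v _ [f ->] _ [g ->]|a u _ [f ->]].
  - have pw : perm_eq w (cmword (wordcm w)) by rewrite -perm_wordcm cmwordK.
    have [f fE] := IHd _ (fil_le (wd : (size w <= d)%N) (fil_perm pw)).
    exists (mX S (wordcm w) + f); rewrite /symm raddfD /= lext_mX.
    by rewrite -/(symm f) -fE addrC subrK.
  - by exists 0; rewrite /symm raddf0.
  - by exists (f + g); rewrite /symm raddfD.
  - by exists (a *: f); rewrite /symm linearZ.
elim: (iota_gen u) => {u} [_ [x _ <-]||u v _ [d du] _ [e ev]|a u _ [d du]
  |u v _ [d du] _ [e ev]].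
- by exists 2%N; exact: fil_iota.
- by exists 1%N; apply: LS_gen; exists [::] => //; rewrite /wprod big_nil.
- by exists (d + e)%N; apply: LS_add;
    [apply: fil_le du; lia | apply: fil_le ev; lia].
- by exists d; exact: LS_scale.
- by exists (d + e)%N; apply: filM du ev => c c'; lia.
Qed.

Lemma has_symbol_wprod w : has_symbol (wprod w) (wordcm w).
Proof.
elim: w => [|i w IH]; rewrite /wprod /wordcm.
  by rewrite !big_nil; exact: has_symbol1.
by rewrite !big_cons; apply: has_symbolM => //; exact: has_symbol_bas.
Qed.

(** Any [u] is a combination of ordered products with distinct symbols, and their images under [phi]
    are linearly independent. *)
Lemma phi_inj u : phi u = 0 -> u = 0.
Proof.
have [f ->] := symm_surj u; rewrite /symm /lext raddf_sum /= => f0.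
rewrite big1_seq // => m /andP[_ mf].
rewrite (@symbol_independent _ (supp f) (fun m => mcf m f)
  (fun m => wprod (cmword m)) id) ?scale0r //.
- exact: supp_uniq.
- by move=> x _; rewrite -{2}(cmwordK x); exact: has_symbol_wprod.
- by rewrite -[RHS]f0; apply: eq_bigr => x _; rewrite linearZ.
Qed.

Lemma has_symbol_bas_exp t e :
  has_symbol (iota (b t) ^+ e) (wordcm (nseq e t)).
Proof.
rewrite -{2}(muln1 e); apply: has_symbol_exp.
by rewrite /wordcm big_seq1; exact: has_symbol_bas.
Qed.

(** [iota x] raises degrees by at most one, so subtracting x^[p] leaves the symbol of x^p
    unchanged. *)
Lemma has_symbolB u m x :
  (1 < mdeg m)%N -> has_symbol u m -> has_symbol (u - iota x) m.
Proof.
move=> m_gt1 um n f nf.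
have -> : rho (u - iota x) f = rho u f - act b x f by rewrite -rhoE raddfB.
rewrite addrAC; apply: deg_ltB.
  exact: um.
apply: (@deg_lt_le _ _ _ (1 + n).+1); first by rewrite add1n -addn2 leq_add2l.
rewrite actE; apply: deg_ltD; first by apply: deg_ltM => //; exact: deg_lt_io.
by apply: deg_lt_le (deg_lt_ldir x nf).
Qed.

Lemma centreP c : (forall x, c * iota x = iota x * c) -> centre U c.
Proof.
move=> cx u; elim: (iota_gen u) => {u} [_ [x _ <-]||u v _ IHu _ IHv|a u _ IH
  |u v _ IHu _ IHv].
- exact: cx.
- by rewrite mulr1 mul1r.
- by rewrite mulrDl mulrDr IHu IHv.
- by rewrite -scalerAl -scalerAr IH.
- by rewrite mulrA IHu -mulrA IHv mulrA.
Qed.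

Lemma centre_subalg (C : set U) :
  (forall u, C u -> centre U u) -> forall u, gen_subalg C u -> centre U u.
Proof.
move=> CC u; elim=> {u} [u /CC //||u v _ IHu _ IHv|a u _ IH|u v _ IHu _ IHv] w.
- by rewrite mulr1 mul1r.
- by rewrite mulrDl mulrDr IHu IHv.
- by rewrite -scalerAl -scalerAr IH.
- by rewrite -mulrA IHv mulrA IHu mulrA.
Qed.

(** Induction on the degree of [phi u]: subtracting a combination of elements of the subalgebra with
    the right symbols leaves a central element whose image has smaller degree, and [phi_inj] ends
    the descent. *)
Lemma centre_generated (C : set U) :
    (forall u, C u -> centre U u) ->
    (forall f m, (forall x, adj x f = 0) -> m \in supp f ->
       exists2 u, gen_subalg C u & has_symbol u m) ->
  forall u, centre U u -> gen_subalg C u.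
Proof.
move=> CC inv u; have [d] := deg_lt_ex (phi u).
have C0 : gen_subalg C 0.
  by rewrite -(scale0r 1); apply: SA_scale; exact: SA_one.
elim: d u => [|d IH] u ud uC; first by rewrite (phi_inj (deg_lt_eq0 ud)).
(* [choice] needs a total function; its value 0 off the support never enters the sum [w]. *)
have /choice[v vP] : forall m, exists v, m \in supp (phi u) ->
    gen_subalg C v /\ has_symbol v m.
  move=> m; case: (boolP (m \in supp (phi u))) => [mu|_]; last by exists 0.
  have [v vC vm] := inv _ _ (fun x => centre_invariant x uC) mu.
  by exists v.
pose w := \sum_(m <- supp (phi u)) mcf m (phi u) *: v m.
have wC : gen_subalg C w.
  rewrite /w big_seq; elim/big_ind: _ => [//|x y|m mu]; first exact: SA_add.
  by apply: SA_scale; have [] := vP _ mu.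
rewrite -(subrK w u); apply: SA_add => //; apply: IH.
  rewrite raddfB /= {1}(mX_expand (phi u)) /w raddf_sum /= -sumrB.
  apply: deg_lt_sum => m mu; rewrite linearZ /= -scalerBr; apply: deg_ltZ.
  rewrite -opprB -scaleN1r; apply: deg_ltZ.
  apply: deg_lt_le (phi_symbol (vP _ mu).2).
  by rewrite -ltnS; exact: deg_lt_supp mu.
by move=> y; rewrite mulrBl mulrBr uC (centre_subalg CC wC).
Qed.

Lemma wordcm_nseqE d (t i : I) : wordcm (nseq d t) i = ((t == i) * d)%N.
Proof. by rewrite wordcmE count_nseq. Qed.

(** * Algebraic independence from symbols *)

Section Independence.
Import mpoly.

(** A monomial in the [x j] has as symbol a product of powers of distinct variables; as each [d j]
    is positive, the exponents can be recovered from it. *)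
Lemma symbol_alg_independent (J : Type) (x : J -> U) (t : J -> I)
    (d : J -> nat) :
    injective t -> (forall j, 0 < d j)%N ->
    (forall j, has_symbol (x j) (wordcm (nseq (d j) (t j)))) ->
  alg_independent x.
Proof.
move=> t_inj d_gt0 xs l i i_inj q q0.
pose u (M : multinom l) : U := mmap1 (x \o i) M.
pose nu (M : multinom l) : {cmonom I} :=
  \big[@mmul _/@mone _]_(j < l) wordcm (nseq (M j * d (i j))%N (t (i j))).
have nuE M j : nu M (t (i j)) = (M j * d (i j))%N.
  rewrite /nu; transitivity (\sum_(j' < l) (j' == j) * (M j' * d (i j')))%N.
    elim/big_ind2: _ => [|m1 n1 m2 n2 <- <-|j' _]; first exact: cm1.
      by rewrite cmM.
    rewrite wordcm_nseqE; congr (nat_of_bool _ * _)%N.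
    exact: (inj_eq (inj_comp t_inj i_inj)).
  rewrite (bigD1 j) //= eqxx mul1n big1 ?addn0 // => j' /negPf ->.
  exact: mul0n.
have us M : has_symbol (u M) (nu M).
  rewrite /u /mmap1 /nu.
  elim/big_ind2: _ => [|u1 m1 u2 m2|j _]; first exact: has_symbol1.
    exact: has_symbolM.
  by apply: has_symbol_exp; exact: xs.
have nu_inj : {in msupp q &, injective nu}.
  move=> M M' _ _ MM'; apply/mnmP => j.
  apply/eqP; rewrite -(eqn_pmul2r (d_gt0 (i j))) -!nuE MM'.
  exact: eqxx.
apply/mpolyP => M; rewrite mcoeff0.
case: (boolP (M \in msupp q)) => [Mq|]; last first.
  by rewrite mcoeff_msupp negbK => /eqP.
apply: (@symbol_independent _ _ (fun M => mcoeff M q) u nu (msupp_uniq q)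
  nu_inj (fun M _ => us M) _ M Mq).
transitivity (phi (mmap (in_alg U) (x \o i) q)); last by rewrite q0 raddf0.
rewrite /mmap raddf_sum; apply: eq_bigr => M' _.
by rewrite -/(u M') /= mulr_algl linearZ.
Qed.

End Independence.

End PBW.

(** * A basis of the shifted current algebra *)

Section PolyLinear.
Variables (k : comNzRingType) (V : lmodType k) (h : nat -> V).

Definition poly_lin (q : {poly k}) : V := \sum_(r < size q) q`_r *: h r.

Lemma poly_lin_wide d (q : {poly k}) : (size q <= d)%N ->
  poly_lin q = \sum_(r < d) q`_r *: h r.
Proof.
move=> qd; rewrite /poly_lin (big_ord_widen _ (fun r => q`_r *: h r) qd).
rewrite big_mkcond /=; apply: eq_bigr => r _.
case: ltnP => // /(nth_default 0) ->.
by rewrite scale0r.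
Qed.

Lemma poly_lin_is_linear : linear poly_lin.
Proof.
move=> a q q'; pose d := maxn (size (a *: q + q')) (maxn (size q) (size q')).
rewrite !(@poly_lin_wide d); try by rewrite /d; lia.
rewrite scaler_sumr -big_split /=; apply: eq_bigr => r _.
by rewrite coefD coefZ scalerDl scalerA.
Qed.

HB.instance Definition _ :=
  GRing.isLinear.Build k {poly k} V *:%R poly_lin poly_lin_is_linear.

Lemma poly_linXn r : poly_lin 'X^r = h r.
Proof.
rewrite /poly_lin size_polyXn big_ord_recr /= coefXn eqxx scale1r.
rewrite big1 ?add0r //.
by move=> i _; rewrite coefXn ltn_eqF // scale0r.
Qed.

End PolyLinear.

Section ShiftedBasis.
Variables (k : fieldType) (n : nat) (s : shift_matrix n.+1).
Local Notation L := (shifted k s).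

Definition entry (i j : 'I_n.+1) (r : nat) (x : L) : k :=
  (shifted_val x i j)`_r.

Lemma shifted_val_lin : linear (@shifted_val k n.+1 s).
Proof.
by move=> a x y; exact: (linearP (\val : {linear L -> current k n.+1})).
Qed.

HB.instance Definition _ := GRing.isLinear.Build k L (current k n.+1) *:%R
  (@shifted_val k n.+1 s) shifted_val_lin.

Lemma entry_lin i j r a x y :
  entry i j r (a *: x + y) = a * entry i j r x + entry i j r y.
Proof.
by rewrite /entry shifted_val_lin !mxE coefD coefCM.
Qed.

Lemma cur_e_entry (i j i' j' : 'I_n.+1) r :
  cur_e k i' j' r i j = ((i == i') && (j == j'))%:R * 'X^r.
Proof. by rewrite !mxE mulrC. Qed.

Lemma entry_e i j r i' j' r' (sr : (s i' j' <= r')%N) :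
  entry i j r (sh_e k sr) = [&& i == i', j == j' & r == r']%:R.
Proof.
rewrite /entry /= cur_e_entry mulr_natl coefMn coefXn andbA.
by case: (_ && _); rewrite ?mulr1n.
Qed.

Lemma sh_z_val r : shifted_val (sh_z k s r) = 'X^r *: 1%:M.
Proof.
rewrite /sh_z raddf_sum /= mx1_sum_delta scaler_sumr.
by apply: eq_bigr => i _.
Qed.

Lemma entry_z i j r r' : entry i j r (sh_z k s r') = ((i == j) && (r == r'))%:R.
Proof.
rewrite /entry sh_z_val !mxE mulr_natr coefMn coefXn.
by case: (i == j); rewrite ?mulr1n.
Qed.

Lemma entry_small (x : L) :
  exists N, forall i j r, (N <= r)%N -> entry i j r x = 0.
Proof.
exists (\max_i \max_j size (shifted_val x i j))%N => i j r Nr.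
apply: nth_default; apply: leq_trans Nr.
by apply: leq_trans (leq_bigmax i); exact: (leq_bigmax j).
Qed.

Definition sh_mul (x y : L) : L :=
  Shifted (in_shiftedM (shiftedP x) (shiftedP y)).

Lemma sh_mul_linl z : linear (sh_mul^~ z).
Proof. by move=> a x y; apply: val_inj; rewrite /= mulrDl -cur_scaleAl. Qed.

Lemma sh_mul_linr z : linear (sh_mul z).
Proof. by move=> a x y; apply: val_inj; rewrite /= mulrDr -cur_scaleAr. Qed.

Lemma sh_mulA : associative sh_mul.
Proof. by move=> x y z; apply: val_inj; rewrite /= mulrA. Qed.

Lemma sh_lieE (x y : L) : lie x y = sh_mul x y - sh_mul y x.
Proof. exact: val_inj. Qed.

Definition sh_index :=
  {x : 'I_n.+1 * 'I_n.+1 * nat | (s x.1.1 x.1.2 <= x.2)%N}.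
HB.instance Definition _ := Choice.on sh_index.

Definition diag0 (i j : 'I_n.+1) : bool := (i == ord0) && (j == ord0).

(* Replacing e_{1,1} t^r by z_r makes the z_r themselves variables of S.      *)
Definition sh_bas (t : sh_index) : L :=
  let: exist (i, j, r) sr := t in
  if diag0 i j then sh_z k s r else sh_e k sr.

Lemma span_sh_bas x : lin_span (range sh_bas) x.
Proof.
have base i j r (sr : (s i j <= r)%N) : lin_span (range sh_bas) (sh_e k sr).
  have ndiag (i' j' : 'I_n.+1) r' (sr' : (s i' j' <= r')%N) : ~~ diag0 i' j' ->
      lin_span (range sh_bas) (sh_e k sr').
    move=> ij; apply: LS_gen; exists (exist _ (i', j', r') sr') => //=.
    by rewrite (negPf ij).
  case: (boolP (diag0 i j)) => [/andP[/eqP i0 /eqP j0]|]; last exact: ndiag.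
  subst i j.
  have -> : sh_e k sr = sh_z k s r - \sum_(i | i != ord0) sh_e_diag k s i r.
    rewrite /sh_z (bigD1 ord0) //= addrK /sh_e_diag; exact: val_inj.
  rewrite -scaleN1r; apply: LS_add.
    apply: LS_gen; exists (exist _ (ord0, ord0, r) sr) => //=.
  apply: LS_scale; elim/big_ind: _ => [|y z|i i0]; first exact: LS_0.
    exact: LS_add.
  by apply: ndiag; rewrite /diag0 (negPf i0).
case: x => x px; have := px; rewrite unfold_in => /asboolP sx.
elim: sx px => {x} [_ [i [j [r [sr ->]]]]||x y sx IHx sy IHy|a x sx IH] px.
- by have := base _ _ _ sr; congr lin_span; exact: val_inj.
- have -> : Shifted px = 0 by apply: val_inj; rewrite raddf0.
  exact: LS_0.
- have xS : x \in in_shifted (k := k) s by apply/asboolP.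
  have yS : y \in in_shifted (k := k) s by apply/asboolP.
  have -> : Shifted px = Shifted xS + Shifted yS.
    by apply: val_inj; rewrite raddfD.
  exact: LS_add.
- have xS : x \in in_shifted (k := k) s by apply/asboolP.
  have -> : Shifted px = a *: Shifted xS by apply: val_inj; rewrite linearZ.
  exact: LS_scale.
Qed.

Variable S : polyAlg k sh_index.

(* Set to 0 below the shift, where e_{i,j} t^r is not in g_sigma.             *)
Definition evar (i j : 'I_n.+1) (r : nat) : S :=
  if insub (i, j, r) is Some t then var S t else 0.

Definition elin (i j : 'I_n.+1) (r : nat) : S :=
  if diag0 i j then evar i j r - \sum_(l | l != ord0) evar l l r
  else evar i j r.

Definition sh_io (x : L) : S :=
  \sum_i \sum_j poly_lin (elin i j) (shifted_val x i j).

Lemma sh_io_linear : linear sh_io.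
Proof.
move=> a x y; rewrite /sh_io scaler_sumr -big_split; apply: eq_bigr => i _.
rewrite scaler_sumr -big_split; apply: eq_bigr => j _ /=.
by rewrite !mxE mul_polyC linearP.
Qed.

HB.instance Definition _ := GRing.isLinear.Build k L S *:%R sh_io sh_io_linear.

Lemma sh_io_e i j r (sr : (s i j <= r)%N) : sh_io (sh_e k sr) = elin i j r.
Proof.
rewrite /sh_io (bigD1 i) //= (bigD1 j) //= cur_e_entry !eqxx mul1r poly_linXn.
rewrite !big1 ?addr0 // => [i' /negPf i'i|j' /negPf j'j].
  by rewrite big1 // => j' _; rewrite cur_e_entry i'i mul0r raddf0.
by rewrite cur_e_entry j'j andbF mul0r raddf0.
Qed.

Lemma sh_io_bas t : sh_io (sh_bas t) = var S t.
Proof.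
case: t => [[[i j] r] sr]; rewrite /sh_bas.
have evarE : evar i j r = var S (exist _ (i, j, r) sr).
  rewrite /evar; case: insubP => [t _ tE|]; last by rewrite /= sr.
  by congr var; exact: val_inj.
case: (boolP (diag0 i j)) => [/andP[/eqP i0 /eqP j0]|ij]; last first.
  by rewrite sh_io_e /elin (negPf ij).
subst i j; rewrite /sh_z raddf_sum (bigD1 ord0) //= sh_io_e /elin /diag0 eqxx.
rewrite -evarE -[RHS](subrK (\sum_(l | l != ord0) evar l l r)); congr (_ + _).
by apply: eq_bigr => l /negPf l0; rewrite sh_io_e /elin /diag0 l0.
Qed.

Definition sh_basis : lieBasis L S :=
  LieBasis sh_mul_linl sh_mul_linr sh_mulA sh_lieE sh_io_linear sh_io_bas
    span_sh_bas.

End ShiftedBasis.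

(** * Invariants of the symmetric algebra *)

Section FunctionalDerivations.
Variables (k : fieldType) (L : lieAlgType k) (I : choiceType).
Variables (S : polyAlg k I) (b : lieBasis L S).

Definition is_functional (lam : L -> k) : Prop :=
  forall a x y, lam (a *: x + y) = a * lam x + lam y.

Definition fder (lam : L -> k) : endo S := ddir b (fun x => (lam x)%:A).

Lemma fder_is_der lam : is_der (fder lam).
Proof. exact: ddir_is_der. Qed.

Lemma fder_io lam x : is_functional lam -> fder lam (io b x) = (lam x)%:A.
Proof.
by move=> lamP; apply: ddir_io => a y z; rewrite lamP scalerDl scalerA.
Qed.

Lemma fder_commutator lam a : is_functional lam ->
  fder lam * adj b a - adj b a * fder lam = fder (fun x => lam (lie a x)).
Proof.
move=> lamP; apply: ddir_ext.
- by move=> c y z; rewrite lie_linearr lamP scalerDl scalerA.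
- by apply: is_der_commutator; [exact: fder_is_der | exact: adj_is_der].
move=> x; rewrite endoBE !endoME adj_io !fder_io // endo_scaleE.
by rewrite (is_der1 (@adj_is_der _ _ _ _ b a)) scaler0 subr0.
Qed.

(** By [fder_commutator], the vanishing of a derivative of an invariant passes from [lam] to its
    pullback along ad a. *)
Lemma fder_invariant lam a f : is_functional lam ->
    (forall x, adj b x f = 0) -> fder lam f = 0 ->
  fder (fun x => lam (lie a x)) f = 0.
Proof.
move=> lamP f_inv lamf; rewrite -fder_commutator // endoBE !endoME f_inv lamf.
by rewrite !endo_0 subrr.
Qed.

End FunctionalDerivations.

Section ShiftedInvariants.
Variables (k : fieldType) (n : nat) (s : shift_matrix n.+1).
Variable S : polyAlg k (sh_index s).
Local Notation L := (shifted k s).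
Variable b : lieBasis L S.
Hypothesis basE : forall t, b t = sh_bas k t.
Local Notation ent := (@entry k n s).

Lemma entry_functional i j r : is_functional (ent i j r).
Proof. by move=> a x y; exact: entry_lin. Qed.

(** Multiplication by t^N shifts coefficients, so a coordinate in t-degree N + r pulls back to
    coordinates in t-degree r. *)
Lemma entry_bracket i j r c d N (sN : (s c d <= N)%N) (x : L) :
  ent i j (N + r) (lie (sh_e k sN) x) =
    (i == c)%:R * ent d j r x - (j == d)%:R * ent i c r x.
Proof.
rewrite /entry sh_lieE raddfB /= !mxE coefB; congr (_ - _).
  rewrite (bigD1 d) //= big1 ?addr0 => [|l /negPf ld]; last first.
    by rewrite cur_e_entry ld andbF mul0r mul0r.
  rewrite cur_e_entry eqxx andbT -mulrA.
  case: (i == c); last by rewrite !mul0r coef0.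
  by rewrite !mul1r coefXnM ltnNge leq_addr addKn.
rewrite (bigD1 c) //= big1 ?addr0 => [|l /negPf lc]; last first.
  by rewrite cur_e_entry lc mul0r mulr0.
rewrite cur_e_entry eqxx /= mulrCA.
case: (j == d); last by rewrite !mul0r coef0.
by rewrite !mul1r coefMXn ltnNge leq_addr addKn.
Qed.

(** Only finitely many variables occur in [f], each standing for a matrix of bounded t-degree. *)
Lemma fder_entry_small (f : S) :
  exists N, forall i j r, (N <= r)%N -> fder b (ent i j r) f = 0.
Proof.
elim/polyAlg_ind: f => [|t f [N Nf]|a f g [N Nf] [N' Ng]].
- by exists 0%N => i j r _; rewrite (is_der1 (@fder_is_der _ _ _ _ b _)).
- have [N' Nt] := entry_small (b t).
  exists (maxn N N') => i j r; rewrite geq_max => /andP[Nr N'r].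
  rewrite fder_is_der -(io_bas b) fder_io; last exact: entry_functional.
  by rewrite Nt // Nf // scale0r mul0r mulr0 addr0.
- exists (maxn N N') => i j r; rewrite geq_max => /andP[Nr N'r].
  by rewrite endo_lin Nf // Ng // scaler0 addr0.
Qed.

Lemma fder_ext lam lam' : lam =1 lam' -> fder b lam = fder b lam'.
Proof. by move=> ll; congr fder; apply: funext. Qed.

(** Coordinates with respect to [sh_bas]: z_r has every diagonal entry t^r and carries the (1,1)
    entry, so e_{i,i} t^r has coordinate x_{i,i} - x_{1,1} for i <> 1. *)
Definition dual_bas (t : sh_index s) (x : L) : k :=
  let: (i, j, r) := val t in
  ent i j r x - ((i == j) && ~~ diag0 i j)%:R * ent ord0 ord0 r x.

Lemma dual_bas_functional t : is_functional (dual_bas t).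
Proof.
move=> a x y; rewrite /dual_bas; case: (val t) => [[i j] r].
by rewrite !entry_lin; ring.
Qed.

Lemma dual_basE t t' : dual_bas t (b t') = (t' == t)%:R.
Proof.
rewrite basE.
rewrite -val_eqE /dual_bas; case: t t' => [[[i j] r] sr] [[[i' j'] r'] sr'] /=.
rewrite !xpair_eqE [i' == i]eq_sym [j' == j]eq_sym [r' == r]eq_sym.
case: (boolP (diag0 i' j')) => [/andP[/eqP -> /eqP ->]|ij0].
  rewrite !entry_z eqxx /= /diag0.
  case: (eqVneq i j) => [->|ij] /=.
    by case: (j == ord0); case: (r == r');
      rewrite /= ?mul0r ?mul1r ?subr0 ?subrr.
  rewrite mul0r subr0; case: (eqVneq i ord0) ij => [->|_ _] //=.
  by rewrite eq_sym => /negPf ->.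
rewrite !entry_e; case: (boolP ((i == j) && ~~ diag0 i j)) => [|_].
  move=> /andP[/eqP -> _]; rewrite /= mul1r ![ord0 == _]eq_sym.
  have -> : [&& i' == ord0, j' == ord0 & r == r'] = false.
    by rewrite andbA; move: ij0; rewrite /diag0 => /negPf ->.
  by rewrite subr0 andbA.
by rewrite /= mul0r subr0 andbA.
Qed.

Lemma fder_dual_bas t : fder b (dual_bas t) = pder S t.
Proof.
apply: is_der_ext => [||t']; [exact: fder_is_der | exact: pder_is_der |].
rewrite [RHS]pder_var -(io_bas b) fder_io; last exact: dual_bas_functional.
by rewrite dual_basE; case: (t' == t); rewrite ?scale1r ?scale0r.
Qed.

(** The coordinate dual to [t] is the pullback, along some ad(e_{c,d} t^N), of an entry in t-degree
    at least N; for large N the derivative along that entry kills [f]. *)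
Lemma invariant_pder (f : S) (t : sh_index s) :
    (forall x, adj b x f = 0) -> ~~ diag0 (val t).1.1 (val t).1.2 ->
  pder S t f = 0.
Proof.
move=> f_inv; rewrite -fder_dual_bas.
case: t => [[[i j] r] /= sr] ij0; have [N0 Nf] := fder_entry_small f.
case: (eqVneq i j) => [ij|ij]; last first.
  (* The (j,j) entry of [e_{j,i} t^N, x] is t^N x_{i,j} when i <> j.          *)
  pose N := maxn N0 (s j i); have sN : (s j i <= N)%N by rewrite leq_maxr.
  have <- := @fder_invariant _ _ _ _ b (ent j j (N + r)) (sh_e k sN) f.
  - congr (endo_fun _ f); apply: fder_ext => x; rewrite entry_bracket /dual_bas.
    by rewrite /= (negPf ij) /= [j == i]eq_sym (negPf ij) eqxx !mul0r mul1r.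
  - exact: entry_functional.
  - exact: f_inv.
  - by apply: Nf; rewrite (leq_trans (leq_maxl _ (s j i))) // leq_addr.
subst j; have i0 : i != ord0 by move: ij0; rewrite /diag0 andbb.
(* The (1,i) entry of [e_{1,i} t^N, x] is t^N (x_{i,i} - x_{1,1}).            *)
pose N := maxn N0 (s ord0 i); have sN : (s ord0 i <= N)%N by rewrite leq_maxr.
have <- := @fder_invariant _ _ _ _ b (ent ord0 i (N + r)) (sh_e k sN) f.
- congr (endo_fun _ f); apply: fder_ext => x; rewrite entry_bracket /dual_bas.
  by rewrite /= ij0 !eqxx /= !mul1r.
- exact: entry_functional.
- exact: f_inv.
- by apply: Nf; rewrite (leq_trans (leq_maxl _ (s ord0 i))) // leq_addr.
Qed.

End ShiftedInvariants.

(** * The generators of the centre *)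

Lemma iter_ad_pchar_commutator p (R : nzRingType) (w v : R) :
  p \in [pchar R] -> iter_ad w v p = w ^+ p * v - v * w ^+ p.
Proof.
move=> hp; have p_pr := pcharf_prime hp; have p_gt0 := prime_gt0 p_pr.
rewrite iter_adE big_ord_recl /= bin0 subn0 !mul1r mulr1; congr (_ + _).
rewrite -(prednK p_gt0) big_ord_recr /= prednK // /bump /= add1n prednK //.
rewrite subnn binn mulr1 mul1r big1 ?add0r => [|i _].
  (* The last term carries the sign (-1)^p, which is -1 for odd p and also for p = 2, where 1 =
     -1. *)
  rewrite -mulNr; case: (even_prime p_pr) => [p2|podd]; last first.
    by rewrite -signr_odd podd expr1 mulN1r mulNr.
  rewrite p2 expr2 mulrNN mulr1 mul1r mulNr oppr_pchar2 //.
  by rewrite -p2.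
have : ('C(p, i.+1))%:R = 0 :> R.
  apply/eqP; rewrite -(dvdn_pcharf hp) prime_dvd_bin //.
  by case: i => i /= ip; lia.
by rewrite add1n => ->; rewrite mulr0 mul0r.
Qed.

Section ShiftedCentre.
Variables (k : fieldType) (p : nat) (hp : p \in [pchar k]).
Variables (n : nat) (s : shift_matrix n.+1).
Local Notation L := (shifted k s).
Variables (S : polyAlg k (sh_index s)) (b : lieBasis L S).
Hypothesis basE : forall t, b t = sh_bas k t.
Variables (U : algType k) (iota : {linear L -> U}).
Hypothesis iota_lie : forall x y,
  iota (lie x y) = iota x * iota y - iota y * iota x.
Hypothesis iota_gen : forall u, gen_subalg (range iota) u.
Variable rho : {lrmorphism U -> endo S}.
Hypothesis rhoE : forall x, rho (iota x) = act b x.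
Local Notation has_symbol := (has_symbol rho).

Definition pelt (x : L) : U := iota x ^+ p - iota (sh_pmap p x).

Definition cgen (c : centre_index s) : U :=
  match c with
  | CI_z r => iota (sh_z k s r)
  | CI_p i j r sr _ => pelt (sh_e k sr)
  end.

Lemma iter_lie_pmap (x y : L) : iter p (lie x) y = lie (sh_pmap p x) y.
Proof.
apply: val_inj => /=.
have hM : p \in [pchar 'M[{poly k}]_n.+1].
  rewrite inE (pcharf_prime hp) /=.
  rewrite -(rmorph_nat (@scalar_mx {poly k} n.+1)) pcharf0 ?pchar_poly //.
  by rewrite raddf0.
rewrite -[RHS](iter_ad_pchar_commutator (R := 'M[{poly k}]_n.+1)) //.
by elim: p => //= m ->.
Qed.

Lemma iota_iter_lie x y m :
  iota (iter m (lie x) y) = iter_ad (iota x) (iota y) m.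
Proof. by elim: m => //= m IH; rewrite iota_lie IH. Qed.

(** Both x^p and x^[p] induce ad(x)^p: the first by the binomial identity in U, the second by the
    same identity for matrices. *)
Lemma centre_pelt x : centre U (pelt x).
Proof.
have hU : p \in [pchar U] by rewrite pchar_lalg.
apply: (centreP iota_gen) => y; apply/eqP.
rewrite -subr_eq0 /pelt mulrBl mulrBr opprD opprK addrACA.
rewrite -iter_ad_pchar_commutator // -iota_iter_lie.
by rewrite iter_lie_pmap iota_lie [X in _ + X]addrC -[X in _ + X]opprB subrr.
Qed.

Lemma centre_z r : centre U (iota (sh_z k s r)).
Proof.
apply: (centreP iota_gen) => y; apply/eqP; rewrite -subr_eq0 -iota_lie.
have -> : lie (sh_z k s r) y = 0; last by rewrite raddf0.
apply: val_inj; rewrite sh_lieE raddfB raddf0 /= sh_z_val.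
by rewrite -[X in X - _]scalemxAl -[X in _ - X]scalemxAr mul1mx mulmx1 subrr.
Qed.

Lemma centre_cgen c : centre U (cgen c).
Proof. by case: c => *; [exact: centre_z | exact: centre_pelt]. Qed.

Definition cidx (c : centre_index s) : sh_index s :=
  match c with
  | CI_z r => exist _ (ord0, ord0, r) (shift_diag_le s ord0 r)
  | CI_p i j r sr _ => exist _ (i, j, r) sr
  end.

Definition cdeg (c : centre_index s) : nat := if c is CI_z _ then 1%N else p.

Lemma cidx_inj : injective cidx.
Proof.
move=> [r|i j r sr ij] [r'|i' j' r' sr' ij'] /(congr1 val) /= [].
- by move=> ->.
- by move=> i0 j0 _; case/negP: ij'; rewrite -i0 -j0.
- by move=> i0 j0 _; case/negP: ij; rewrite i0 j0.
- move=> ei ej er; subst i' j' r'.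
  by rewrite (bool_irrelevance sr' sr) (bool_irrelevance ij' ij).
Qed.

Lemma p_gt1 : (1 < p)%N.
Proof. exact: prime_gt1 (pcharf_prime hp). Qed.

Lemma cgen_symbol c : has_symbol (cgen c) (wordcm (nseq (cdeg c) (cidx c))).
Proof.
case: c => [r|i j r sr ij] /=.
  have := @has_symbol_bas_exp _ _ _ _ _ _ _ _ rhoE (cidx (CI_z s r)) 1.
  by rewrite expr1 basE.
apply: (has_symbolB rhoE); first by rewrite mdeg_wordcm size_nseq p_gt1.
have := @has_symbol_bas_exp _ _ _ _ _ _ _ _ rhoE (cidx (CI_p sr ij)) p.
by rewrite basE /= /diag0; move: ij; rewrite xpair_eqE => /negPf ->.
Qed.

Local Notation A := (gen_subalg (range cgen)).

Lemma gen_subalgX (u : U) (C : set U) e :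
  gen_subalg C u -> gen_subalg C (u ^+ e).
Proof.
move=> uC; elim: e => [|e IH]; first exact: SA_one.
by rewrite exprS; exact: SA_mul.
Qed.

(** Treat each variable separately: its power in [m] is the symbol of a power of one generator,
    since away from the z_r the exponent is divisible by p. *)
Lemma invariant_symbol (f : S) m :
  (forall x, adj b x f = 0) -> m \in supp f -> exists2 u, A u & has_symbol u m.
Proof.
move=> f_inv mf.
have one t : exists2 u, A u & has_symbol u (wordcm (nseq (m t) t)).
  have gen c e : cidx c = t -> m t = (e * cdeg c)%N ->
      exists2 u, A u & has_symbol u (wordcm (nseq (m t) t)).
    move=> <- ->; exists (cgen c ^+ e).
      by apply: gen_subalgX; apply: SA_gen; exists c.
    by apply: has_symbol_exp; exact: cgen_symbol.
  case: t gen => [[[i j] r] sr] gen; set t := exist _ _ _ in gen *.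
  case: (boolP (diag0 i j)) => [/andP[/eqP i0 /eqP j0]|ij].
    apply: (gen (CI_z s r) (m t)); last by rewrite muln1.
    by apply: val_inj; rewrite /= i0 j0.
  have ij' : (i : nat, j : nat) != (0, 0)%N by [].
  have := pder0_supp (invariant_pder basE f_inv (t := t) ij) mf.
  move/eqP; rewrite mulf_eq0 -(dvdn_pcharf hp).
  move: mf; rewrite mcf_supp => /negPf ->; rewrite orbF => /dvdnP[e me].
  by apply: (gen (CI_p sr ij') e).
have [u uA um] : exists2 u, A u & has_symbol u (wordcm (cmword m)).
  rewrite /cmword; elim: (finsupp m : seq _) => [|t w [u uA uw]] /=.
    by exists 1; [exact: SA_one | rewrite /wordcm big_nil; exact: has_symbol1].
  have [v vA vt] := one t; exists (v * u); first exact: SA_mul.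
  by rewrite /wordcm big_cat; exact: has_symbolM.
by exists u => //; rewrite -(cmwordK m).
Qed.

Lemma centre_cgenE : centre U = A.
Proof.
apply/seteqP; split=> u.
  apply: (centre_generated iota_lie iota_gen rhoE) => [_ [c _ <-]|f m].
    exact: centre_cgen.
  exact: invariant_symbol.
by apply: centre_subalg => _ [c _ <-]; exact: centre_cgen.
Qed.

Lemma centre_z_peltE :
  centre U = gen_subalg (range (fun r => iota (sh_z k s r))
                         `|` gen_subalg (range pelt)).
Proof.
apply/seteqP; split=> u; last first.
  apply: centre_subalg => v [[r _ <-]|]; first exact: centre_z.
  by apply: centre_subalg => _ [x _ <-]; exact: centre_pelt.
rewrite centre_cgenE.
elim=> {u} [_ [[r|i j r sr ij] _ <-]||u v _ + _|a u _|u v _ + _].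
- by apply: SA_gen; left; exists r.
- by apply: SA_gen; right; apply: SA_gen; exists (sh_e k sr).
- exact: SA_one.
- exact: SA_add.
- exact: SA_scale.
- exact: SA_mul.
Qed.

Lemma cgen_independent : alg_independent cgen.
Proof.
apply: (symbol_alg_independent cidx_inj _ cgen_symbol) => -[] //= *.
exact: ltnW p_gt1.
Qed.

End ShiftedCentre.

Theorem theorem3p4 (k : fieldType) (p : nat) (hp : p \in [pchar k])
    (n : nat) (hn : (0 < n)%N) (s : shift_matrix n) :
  centre (uenv (shifted k s)) =
    gen_subalg (range (fun r : nat => uiota (sh_z k s r)) `|` p_centre k s p)
  /\
  freely_generated_by (@centre_gen k n s p) (centre (uenv (shifted k s))).
Proof.
case: n hn s => [//|n] _ s.
pose S := malg_polyAlg k (sh_index s); pose b := sh_basis S.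
have basE t : b t = sh_bas k t by [].
have [rho rhoE _] := uenv_universal (@act_lie _ _ _ _ b).
have gen := @uenv_gen k (shifted k s).
have lieU := @uiota_lie k (shifted k s).
split; first exact: (centre_z_peltE hp basE lieU gen rhoE).
(* The explicit generators are the x^p - x^[p] at basis vectors, by the formula for the p-map on
   e_{i,j} t^r. *)
have -> : @centre_gen k n.+1 s p = cgen p (@uiota k (shifted k s)).
  apply: funext => -[r|i j r sr ij] //=.
  by rewrite -(p_elt_e sr hp).
split; first exact: (centre_cgenE hp basE lieU gen rhoE).
exact: (cgen_independent hp basE rhoE).
Qed.
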